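(* Let $\mathsf X$ be a finite alphabet, let $T=\mathsf X^*$, and let $G\le \mathrm{Aut}(T)$ be a finitely generated, faithful, contracting, self-replicating self-similar group, with limit $G$-space $\mathcal X_G$. Then the following two quantities are finite and equal: (1) the supremum, over $\xi\in\partial T$, of the number of ends of the graph of germs $\widetilde\Gamma_\xi$; (2) the supremum, over points $\zeta\in\mathcal X_G$ and connected neighbourhoods $U$ of $\zeta$, of the number of connected components of $U\setminus\{\zeta\}$.
   Context: Self-similar groups. $\mathsf X^*$ is the rooted tree of finite words over $\mathsf X$ (each $v$ is joined to $vx$, $x\in\mathsf X$), with boundary $\partial T=\mathsf X^\omega$ the space of right-infinite words. For $g\in\mathrm{Aut}(\mathsf X^* )$ and $v\in\mathsf X^*$ the section $g|_v\in \mathrm{Aut}(\mathsf X^* )$ is defined by $g(vw)=g(v)\,g|_v(w)$ for all $w$. $G\le\mathrm{Aut}(\mathsf X^* )$ is self-similar if $g|_v\in G$ for all $g\in G$, $v\in \mathsf X^*$. It is self-replicating if it acts transitively on $\mathsf X$ and, for $x\in \mathsf X$, the map $G_x\to G$, $g\mapsto g|_x$ from the stabilizer of $x$ is onto. It is contracting if there is a finite set $\mathcal N\subset G$ such that for every $g\in G$ there is $m$ with $g|_v\in\mathcal N$ for all $|v|\ge m$; the smallest such $\mathcal N$ is the nucleus. Limit $G$-space. Let $\mathsf X^{-\omega}$ be the space of left-infinite sequences $\ldots x_2x_1$ (product topology), $G$ discrete. In $\mathsf X^{-\omega}\times G$, write elements as $\ldots x_2x_1\cdot g$. Declare $\ldots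 x_2x_1\cdot g\sim \ldots y_2y_1\cdot h$ if there are $s_n\in\mathcal N$, $n\ge0$, with $s_n(x_n)=y_n$ and $s_n|_{x_n}=s_{n-1}$ for all $n\ge1$, and $s_0g=h$. This is an equivalence relation, and $\mathcal X_G$ is the quotient space, with the right $G$-action induced by right multiplication on $G$. Graphs of germs. For $\xi\in\mathsf X^\omega$, $G_\xi^0$ is the group of elements of $G$ that fix pointwise a neighbourhood of $\xi$ in $\mathsf X^\omega$. For a fixed finite symmetric generating set $S$ of $G$, $\widetilde\Gamma_\xi$ is the Schreier graph with vertex set $G/G_\xi^0$ and edges $(x,sx)$, $s\in S$. The number of ends of a connected locally finite graph is the supremum, over finite vertex sets $\Sigma$, of the number of infinite connected components of the complement of $\Sigma$. *)

(* Defs.v *)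
From HB Require Import structures.
From mathcomp Require Import all_boot all_order all_algebra finmap.
From mathcomp Require Import all_classical all_reals all_analysis.
From Stdlib Require Import Relation_Operators.

Set Implicit Arguments.
Unset Strict Implicit.
Unset Printing Implicit Defensive.

Local Open Scope classical_set_scope.
Local Open Scope nat_scope.

Section TreeAutomorphisms.
Variable X : finType.

Definition tree_edge : rel (seq X) :=
  [rel u v | [exists x, v == rcons u x] || [exists x, u == rcons v x]].

(* The inverse is a field only to make it available as a function; it is
   determined by [tree_aut_fun] (see [tree_autP]). *)
Record tree_aut := TreeAut {
  tree_aut_fun :> seq X -> seq X;
  tree_aut_inv : seq X -> seq X;
  tree_autK : cancel tree_aut_fun tree_aut_inv;
  tree_autVK : cancel tree_aut_inv tree_aut_fun;
  tree_aut_root : tree_aut_fun [::] = [::];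
  tree_aut_edge : {mono tree_aut_fun : u v / tree_edge u v}
}.

Lemma tree_autP (g h : tree_aut) : g =1 h -> g = h.
Proof.
case: g h => [f f' fK f'K f0 fe] [k k' kK k'K k0 ke] /= /funext fk.
subst k; have ff' : f' = k'.
  by apply/funext => u; rewrite -{1}(k'K u) fK.
by subst k'; congr TreeAut; exact: Prop_irrelevance.
Qed.

HB.instance Definition _ := gen_eqMixin tree_aut.
HB.instance Definition _ := gen_choiceMixin tree_aut.

Definition tree_aut1 : tree_aut :=
  @TreeAut id id (fun=> erefl) (fun=> erefl) erefl (fun _ _ => erefl).

Lemma tree_autV_root (g : tree_aut) : tree_aut_inv g [::] = [::].
Proof. by rewrite -[in LHS](tree_aut_root g) tree_autK. Qed.

Lemma tree_autV_edge (g : tree_aut) :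
  {mono tree_aut_inv g : u v / tree_edge u v}.
Proof. by move=> u v; rewrite -(tree_aut_edge g) !tree_autVK. Qed.

Definition tree_autV (g : tree_aut) : tree_aut :=
  TreeAut (tree_autVK g) (tree_autK g) (tree_autV_root g) (tree_autV_edge g).

Fact tree_autM_root (g h : tree_aut) : (g \o h) [::] = [::].
Proof. by rewrite /= !tree_aut_root. Qed.

Fact tree_autM_edge (g h : tree_aut) : {mono g \o h : u v / tree_edge u v}.
Proof. by move=> u v; rewrite /= !tree_aut_edge. Qed.

(* Left actions: [(g * h) v = g (h v)]. *)
Definition tree_autM (g h : tree_aut) : tree_aut :=
  TreeAut (can_comp (tree_autK g) (tree_autK h))
          (can_comp (tree_autVK h) (tree_autVK g))
          (tree_autM_root g h) (tree_autM_edge g h).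

Fact tree_autMA : associative tree_autM.
Proof. by move=> g h k; apply: tree_autP. Qed.
Fact tree_aut1M : left_id tree_aut1 tree_autM.
Proof. by move=> g; apply: tree_autP. Qed.
Fact tree_autM1 : right_id tree_aut1 tree_autM.
Proof. by move=> g; apply: tree_autP. Qed.
Fact tree_autVM : left_inverse tree_aut1 tree_autV tree_autM.
Proof. by move=> g; apply: tree_autP => u /=; rewrite tree_autK. Qed.
Fact tree_autMV : right_inverse tree_aut1 tree_autV tree_autM.
Proof. by move=> g; apply: tree_autP => u /=; rewrite tree_autVK. Qed.

HB.instance Definition _ := isGroup.Build tree_aut
  tree_autMA tree_aut1M tree_autM1 tree_autVM tree_autMV.

Lemma tree_aut_rcons (g : tree_aut) u x :
  exists y, g (rcons u x) = rcons (g u) y.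
Proof.
elim/last_ind: u x => [|u z IH] x.
  have := tree_aut_edge g [::] (rcons [::] x).
  rewrite tree_aut_root /tree_edge /= => E.
  have : [exists y, [:: x] == rcons [::] y] by apply/existsP; exists x.
  move=> e; rewrite e /= in E.
  case/orP: E => /existsP[y /eqP Ey]; first by exists y.
  by move/(congr1 size): Ey; rewrite size_rcons.
have := tree_aut_edge g (rcons u z) (rcons (rcons u z) x).
rewrite /tree_edge /= => E.
have e : [exists y, rcons (rcons u z) x == rcons (rcons u z) y].
  by apply/existsP; exists x.
rewrite e /= in E.
case/orP: E => /existsP[y /eqP Ey]; first by exists y.
have [t Et] := IH z; move: Ey; rewrite Et => /rcons_inj[Eu _].
have := can_inj (tree_autK g) Eu => /(congr1 size).
by rewrite !size_rcons => /eqP; rewrite -[size u]addn0 -!addnS eqn_add2l.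
Qed.

Lemma tree_aut_cat (g : tree_aut) u w :
  g (u ++ w) = g u ++ drop (size u) (g (u ++ w)) /\ size (g u) = size u.
Proof.
have szg v : size (g v) = size v.
  elim/last_ind: v => [|v x IH]; first by rewrite tree_aut_root.
  by have [y ->] := tree_aut_rcons g v x; rewrite !size_rcons IH.
split; last exact: szg.
elim/last_ind: w => [|w x IH].
  by rewrite cats0 drop_oversize ?szg// cats0.
rewrite -rcons_cat; have [y ->] := tree_aut_rcons g (u ++ w) x.
by rewrite IH rcons_cat -[in size u]szg -szg drop_size_cat.
Qed.

Definition section_fun (g : seq X -> seq X) (v w : seq X) : seq X :=
  drop (size v) (g (v ++ w)).

Lemma section_funE (g : tree_aut) v w : g (v ++ w) = g v ++ section_fun g v w.
Proof. by have [] := tree_aut_cat g v w. Qed.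

Lemma size_tree_aut (g : tree_aut) v : size (g v) = size v.
Proof. by have [] := tree_aut_cat g v [::]. Qed.

Fact section_funK (g : tree_aut) v :
  cancel (section_fun g v) (section_fun (tree_autV g) (g v)).
Proof.
move=> w; rewrite {1}/section_fun -section_funE /= tree_autK size_tree_aut.
by rewrite drop_size_cat.
Qed.

Fact section_funVK (g : tree_aut) v :
  cancel (section_fun (tree_autV g) (g v)) (section_fun g v).
Proof.
move=> w; have := section_funK (tree_autV g) (g v) w.
congr (section_fun _ _ _ = _); last by rewrite /= tree_autK.
Qed.

Fact section_fun_root (g : tree_aut) v : section_fun g v [::] = [::].
Proof. by rewrite /section_fun cats0 drop_oversize ?size_tree_aut. Qed.

Lemma tree_edge_cat (v : seq X) : {mono cat v : u w / tree_edge u w}.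
Proof.
move=> u w; rewrite /tree_edge /=; congr (_ || _); apply: eq_existsb => x;
  by rewrite rcons_cat eqseq_cat// eqxx.
Qed.

Fact section_fun_edge (g : tree_aut) v :
  {mono section_fun g v : u w / tree_edge u w}.
Proof.
move=> u w; rewrite -(tree_edge_cat (g v)) -!section_funE tree_aut_edge.
by rewrite tree_edge_cat.
Qed.

(* The section [g|_v]; [sectionE] is its defining property. *)
Definition section (g : tree_aut) (v : seq X) : tree_aut :=
  TreeAut (section_funK g v) (section_funVK g v)
          (section_fun_root g v) (section_fun_edge g v).

Lemma sectionE (g : tree_aut) v w : g (v ++ w) = g v ++ section g v w.
Proof. exact: section_funE. Qed.

Lemma section1 (v : seq X) : section 1%g v = 1%g.
Proof. by apply: tree_autP => w; rewrite /= /section_fun drop_size_cat. Qed.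

Lemma sectionM (g h : tree_aut) v :
  section (g * h)%g v = (section g (h v) * section h v)%g.
Proof.
apply: tree_autP => w; rewrite /= {1}/section_fun/= section_funE section_funE.
by rewrite drop_size_cat ?size_tree_aut.
Qed.

Lemma section_cat (g : tree_aut) u v :
  section g (u ++ v) = section (section g u) v.
Proof.
apply: tree_autP => w.
by rewrite /= /section_fun size_cat -catA drop_drop addnC.
Qed.

Lemma sectionV (g : tree_aut) v : section g^-1%g (g v) = (section g v)^-1%g.
Proof. by apply: tree_autP. Qed.

End TreeAutomorphisms.

Section SelfSimilarGroups.
Variable X : finType.
Implicit Types (G N S : set (tree_aut X)).

(* The action of such a group on the tree is faithful by construction. *)
Definition subgroup G := group_closed (mem G).

Lemma subgroup1 G : subgroup G -> G 1%g.
Proof. by case; rewrite inE. Qed.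

Lemma subgroupV G g : subgroup G -> G g -> G g^-1%g.
Proof. by move=> gG /mem_set Gg; apply: set_mem; exact: (group_closedV gG). Qed.

Lemma subgroupM G g h : subgroup G -> G g -> G h -> G (g * h)%g.
Proof.
move=> gG /mem_set Gg /mem_set Gh; apply: set_mem.
exact: (group_closedM gG).
Qed.

Definition generates S G := smallest subgroup S = G.

Definition self_similar G := forall g v, G g -> G (section g v).

Definition self_replicating G :=
  (forall x y : X, exists2 g, G g & g [:: x] = [:: y]) /\
  (forall (x : X) h, G h ->
     exists g, [/\ G g, g [:: x] = [:: x] & section g [:: x] = h]).

Definition absorbing G N :=
  [/\ finite_set N, N `<=` G &
      forall g, G g -> exists m, forall v, m <= size v -> N (section g v)].

Definition contracting G := exists N, absorbing G N.

(* The smallest absorbing set, see [nucleus_absorbing]. *)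
Definition nucleus G := smallest (absorbing G) set0.

Lemma nucleus_sub G N : absorbing G N -> nucleus G `<=` N.
Proof. by move=> aN g; apply; split. Qed.

Lemma absorbingI G N M :
  absorbing G N -> absorbing G M -> absorbing G (N `&` M).
Proof.
move=> [fN NG aN] [fM MG aM]; split.
- exact: finite_setIl.
- by move=> g [/NG].
move=> g Gg; have [m hm] := aN g Gg; have [k hk] := aM g Gg.
exists (maxn m k) => v; rewrite geq_max => /andP[mv kv].
by split; [exact: hm | exact: hk].
Qed.

Lemma nucleus_absorbing G : contracting G -> absorbing G (nucleus G).
Proof.
move=> [N0 aN0].
pose P n := `[< exists N, absorbing G N /\ #|` fset_set N| = n >].
have exP : exists n, P n by exists #|` fset_set N0|; apply/asboolP; exists N0.
case: (ex_minnP exP) => n /asboolP[N [aN Nn]] minn.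
suff -> : nucleus G = N by [].
apply/seteqP; split; first exact: nucleus_sub.
move=> g Ng M [aM _]; have aI := absorbingI aN aM.
have fN : finite_set N by case: aN.
have fI : finite_set (N `&` M) by case: aI.
have nle : n <= #|` fset_set (N `&` M)|.
  by apply: minn; apply/asboolP; exists (N `&` M).
have sub : (fset_set (N `&` M) `<=` fset_set N)%fset.
  by apply/fsubsetP => h; rewrite !in_fset_set// !inE => -[].
have /eqP E : fset_set (N `&` M) == fset_set N.
  by rewrite eqEfcard sub Nn.
have : g \in fset_set N by rewrite in_fset_set// inE.
by rewrite -E in_fset_set// inE => -[].
Qed.

Section LimitSpace.
Variable G : set (tree_aut X).
Hypotheses (gG : subgroup G) (cG : contracting G).

Lemma nucleusV g : nucleus G g -> nucleus G g^-1%g.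
Proof.
have [fN NG aN] := nucleus_absorbing cG.
have: absorbing G [set g | nucleus G g^-1%g].
  split.
  - rewrite (_ : [set _ | _] = [set h^-1%g | h in nucleus G]).
      exact: finite_image.
    apply/seteqP; split => [h /= Nh|_ [h Nh <-]/=]; last by rewrite invgK.
    by exists h^-1%g; rewrite ?invgK.
  - by move=> h /= /NG /(subgroupV gG); rewrite invgK.
  move=> h Gh; have [m hm] := aN _ (subgroupV gG Gh); exists m => v mv /=.
  by rewrite -sectionV; apply: hm; rewrite size_tree_aut.
by move/nucleus_sub => /[apply].
Qed.

Lemma nucleus1 (x : X) : nucleus G 1%g.
Proof.
have [_ _ /(_ _ (subgroup1 gG))[m hm]] := nucleus_absorbing cG.
by have := hm (nseq m x); rewrite size_nseq section1; exact.
Qed.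

Lemma nucleusM_absorbed : exists m, forall g h v, nucleus G g -> nucleus G h ->
  m <= size v -> nucleus G (section (g * h)%g v).
Proof.
have [fN NG aN] := nucleus_absorbing cG.
pose A := [set (g * h)%g | g in nucleus G & h in nucleus G].
have fA : finite_set A by exact: finite_image2.
have bA g : exists m, A g -> forall v, m <= size v -> nucleus G (section g v).
  have [Ag|nAg] := pselect (A g); last by exists 0 => /nAg.
  have [|m hm] := aN g; last by exists m.
  by case: Ag => h /NG Gh [k /NG Gk <-]; exact: subgroupM.
have [b hb] := choice bA.
exists (\max_(g <- fset_set A) b g) => g h v Ng Nh le.
have Agh : A (g * h)%g by exists g => //; exists h.
apply: (hb _ Agh); apply: leq_trans le.
by apply: leq_bigmax_seq => //; rewrite in_fset_set// inE.
Qed.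

(* A left-infinite word ... x_3 x_2 x_1 is the sequence x with
   [x n] standing for x_(n+1). *)
Definition left_words := prod_topology (fun _ : nat => discrete_topology X).

Definition left_words_group : topologicalType :=
  (left_words * discrete_topology (set_type G))%type.

Definition asymp_equivalent (p q : left_words_group) : Prop :=
  exists s : nat -> tree_aut X,
    [/\ forall n, nucleus G (s n),
        forall n, s n.+1 [:: p.1 n] = [:: q.1 n] /\
                  section (s n.+1) [:: p.1 n] = s n &
        (s 0 * \val p.2)%g = \val q.2].

Lemma asymp_equivalent_refl p : asymp_equivalent p p.
Proof.
exists (fun=> 1%g); split => [n|n|]; first exact: (nucleus1 (p.1 0)).
  by rewrite section1.
by rewrite mul1g.
Qed.

Lemma asymp_equivalent_sym p q : asymp_equivalent p q -> asymp_equivalent q p.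
Proof.
move=> [s [Ns sE s0]]; exists (fun n => (s n)^-1%g); split => [n|n|].
- exact: nucleusV.
- have [sx ss] := sE n; rewrite -sx sectionV ss; split => //.
  exact: (tree_autK (s n.+1)).
- by rewrite -s0 mulKg.
Qed.

Lemma asymp_equivalent_trans p q r :
  asymp_equivalent p q -> asymp_equivalent q r -> asymp_equivalent p r.
Proof.
move=> [s [Ns sE s0]] [t [Nt tE t0]].
have stE n : (t n.+1 * s n.+1)%g [:: p.1 n] = [:: r.1 n] /\
             section (t n.+1 * s n.+1)%g [:: p.1 n] = (t n * s n)%g.
  have [sx ss] := sE n; have [tx ts] := tE n.
  rewrite sectionM sx ss ts; split => //.
  by rewrite -tx -sx.
exists (fun n => (t n * s n)%g); split => [n||].
- have [m hm] := nucleusM_absorbed.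
  have [v [vm <-]] : exists v, size v = m /\
      section (t (n + m) * s (n + m))%g v = (t n * s n)%g.
    elim: m {hm} => [|m [v [vm vE]]].
      exists [::]; split=> //; rewrite addn0; apply: tree_autP => w.
      by rewrite /= /section_fun drop0.
    exists (p.1 (n + m) :: v); split; first by rewrite /= vm.
    by rewrite -cat1s section_cat addnS (stE _).2.
  by apply: hm; rewrite ?vm.
- exact: stE.
- by rewrite -mulgA s0 t0.
Qed.

Definition limit_rel : rel left_words_group :=
  fun p q => `[< asymp_equivalent p q >].

Fact limit_rel_equiv : equiv_class_of limit_rel.
Proof.
split => [p|p q|q p r].
- by apply/asboolP; exact: asymp_equivalent_refl.
- by apply/asboolP/asboolP; exact: asymp_equivalent_sym.
- move=> /asboolP pq /asboolP qr; apply/asboolP.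
  exact: asymp_equivalent_trans pq qr.
Qed.

Definition limit_equiv : equiv_rel left_words_group :=
  EquivRelPack limit_rel_equiv.

Definition limit_space : topologicalType :=
  quotient_topology {eq_quot limit_equiv}%qT.

End LimitSpace.

End SelfSimilarGroups.

Section Germs.
Variable X : finType.
Implicit Types (G S : set (tree_aut X)).

Definition boundary := prod_topology (fun _ : nat => discrete_topology X).

(* The n-th letter of [g xi] is the n-th letter of the image under g of any
   prefix of [xi] of length > n. *)
Definition boundary_act (g : tree_aut X) (xi : boundary) : boundary :=
  fun n => nth (xi n) (g (mkseq xi n.+1)) n.

Definition germ_stabilizer G (xi : boundary) : set (tree_aut X) :=
  [set g | G g /\ \forall eta \near xi, boundary_act g eta = eta].

Definition germ_vertices G (xi : boundary) : set (set (tree_aut X)) :=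
  [set [set (g * h)%g | h in germ_stabilizer G xi] | g in G].

Definition germ_edge S (A B : set (tree_aut X)) : Prop :=
  exists2 s, S s & B = [set (s * a)%g | a in A].

End Germs.

Section Counting.
Local Open Scope ereal_scope.
Variable R : realType.

Definition graph_component (V : Type) (E : V -> V -> Prop) (W : set V) (x : V) :
    set V :=
  [set y | clos_refl_sym_trans V (fun a b => [/\ W a, W b & E a b]) x y].

Definition graph_components (V : Type) (E : V -> V -> Prop) (W : set V) :
    set (set V) :=
  graph_component E W @` W.

Definition number_of_ends (V : Type) (W : set V) (E : V -> V -> Prop) : \bar R :=
  ereal_sup
    [set counting (graph_components E (W `\` F) `&` [set C | infinite_set C])
    | F in [set F | finite_set F /\ F `<=` W]].

Definition components (T : topologicalType) (A : set T) : set (set T) :=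
  connected_component A @` A.

(* The supremum of a set of cardinalities, taken in [0, +oo]: that of the empty
   set is 0, whereas it is -oo for [ereal_sup]. *)
Definition card_sup (K : set (\bar R)) : \bar R := ereal_sup (0 |` K).

End Counting.

(* Main.v *)
Require Import Defs.
From HB Require Import structures.
From mathcomp Require Import all_boot all_order all_algebra finmap.
From mathcomp Require Import all_classical all_reals all_analysis.
From Stdlib Require Import Relation_Operators.

(** A point p = (... x_2 x_1, g) of X^{-w} x G lies, for every n, in the tile
    (x_n ... x_1, g) of level n, and G acts on the tiles of level n by
    h (w, g) = (h(w), h|_w g).  Say that p and q are n-adjacent if an element of
    the nucleus takes the tile of p to that of q.  Then p ~ q iff they are
    n-adjacent for all n, and n-adjacency is a base of the uniformity of the
    limit space.  Since G is self-replicating, it is transitive on the tiles of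
    level n, so that these form the Schreier graph G / K_v, where v is a word of
    length n and K_v the group of the g with g(v) = v and g|_v = 1; if v runs
    over the prefixes of xi, then the K_v increase to the group of trivial germs
    at xi.  Self-replication and contraction make the limit space locally
    connected, uniformly at all scales.

    Cuts to ends: if U \ zeta has k clopen pieces, then every level-n tile that is
    not within a bounded number of tiles of zeta lies in one piece.  A chain of
    tiles from a point of a piece to zeta meets every shell around
    zeta, which bounds k.  Along an ultrafilter, the words x_n ... x_1 read from
    the left converge to some xi, and the piece containing the tile h (x_n ...
    x_1, g) has a limit: this splits the graph of germs at xi, outside a finite
    set of germs, into k infinite parts.

    Ends to cuts: place the graph of germs at xi on the level-n tiles h (xi_n, 1),
    xi_n the prefix of length n.  The components of the complement of a finite
    set F of germs label the tiles outside the lifts of F.  The limits of the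
    lifts of F form a locally finite set Z of the limit space, the labels have
    limits outside Z, and every infinite component comes arbitrarily close to
    the limit zeta of the tiles (xi_n, 1), because its lift from near the base
    tile leaves every bounded region. *)

Set Implicit Arguments.
Unset Strict Implicit.
Unset Printing Implicit Defensive.

Import Order.TTheory GRing.Theory Num.Theory.
Local Open Scope classical_set_scope.
Local Open Scope nat_scope.

(** * Tiles and the nucleus *)

Section Tiles.
Variable X : finType.
Implicit Types (g h : tree_aut X) (t : seq X * tree_aut X) (u v : seq X).

Definition act_tile g t := (g t.1, (section g t.1 * t.2)%g).

(** Words grow to the left, so [extend u t] is a tile inside [t], [size u] levels deeper. *)
Definition extend u t := (u ++ t.1, t.2).

Lemma act_tile1 t : act_tile 1%g t = t.
Proof. by case: t => w g; rewrite /act_tile section1 mul1g. Qed.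

Lemma act_tileM g h t : act_tile (g * h)%g t = act_tile g (act_tile h t).
Proof. by rewrite /act_tile /= sectionM mulgA. Qed.

Lemma act_tileK g t t' : act_tile g t = t' -> t = act_tile g^-1%g t'.
Proof. by move=> <-; rewrite -act_tileM mulVg act_tile1. Qed.

Lemma act_tile_extend g u t :
  act_tile g (extend u t) = extend (g u) (act_tile (section g u) t).
Proof. by rewrite /act_tile /extend /= sectionE section_cat. Qed.

Lemma extend_cat u v t : extend (u ++ v) t = extend u (extend v t).
Proof. by rewrite /extend /= catA. Qed.

Lemma section_nil g : section g [::] = g.
Proof. by apply: tree_autP => w; rewrite /= /section_fun drop0. Qed.

Fixpoint pow (A : set (tree_aut X)) n : set (tree_aut X) :=
  if n is n'.+1 then [set (s * h)%g | s in A & h in pow A n'] else [set 1%g].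

Lemma finite_pow A n : finite_set A -> finite_set (pow A n).
Proof.
move=> fA; elim: n => [|n IH] /=; first exact: finite_set1.
exact: finite_image2.
Qed.

Lemma pow_add A m n g h : pow A m g -> pow A n h -> pow A (m + n) (g * h)%g.
Proof.
move=> + pnh; elim: m g => [|m IH] g /=; first by move->; rewrite mul1g.
move=> [s As [k pk <-]]; rewrite -mulgA; exists s => //.
by exists (k * h)%g => //; exact: IH.
Qed.

Lemma pow1 A g : A g -> pow A 1 g.
Proof. by move=> Ag; exists g => //; exists 1%g => //; rewrite mulg1. Qed.

Lemma pow_le (A : set (tree_aut X)) m n :
  A 1%g -> m <= n -> pow A m `<=` pow A n.
Proof.
move=> A1 /subnK <- g pg; elim: (n - m) => [|k IH] //=.
by exists 1%g => //; exists g => //; rewrite mul1g.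
Qed.

Lemma pow_inv (A : set (tree_aut X)) n g :
  (forall s, A s -> A s^-1%g) -> pow A n g -> pow A n g^-1%g.
Proof.
move=> As; elim: n g => [|n IH] g /=; first by move->; rewrite invg1.
move=> [s /As As1 [h /IH ph <-]]; rewrite invgM.
by have := pow_add ph (pow1 As1); rewrite addn1.
Qed.

Lemma pow_sub (A G : set (tree_aut X)) n :
  subgroup G -> A `<=` G -> pow A n `<=` G.
Proof.
move=> gG AG; elim: n => [|n IH] g /=; first by move->; exact: subgroup1.
by move=> [s /AG Gs [h /IH Gh <-]]; exact: subgroupM.
Qed.

Lemma subgroup_ofP (A : set (tree_aut X)) : A 1%g ->
  (forall g, A g -> A g^-1%g) -> (forall g h, A g -> A h -> A (g * h)%g) ->
  subgroup A.
Proof.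
move=> A1 AV AM; split; first by rewrite inE.
by move=> g h; rewrite !inE => Ag /AV; exact: AM.
Qed.

Lemma generates_pow (S G : set (tree_aut X)) :
  (forall s, S s -> S s^-1%g) -> generates S G -> G = \bigcup_n pow S n.
Proof.
move=> symS <-; apply/seteqP; split.
  apply: smallest_sub; last by move=> s Ss; exists 1 => //; exact: pow1.
  apply: subgroup_ofP; first by exists 0.
  - by move=> g [n _ pg]; exists n => //; exact: pow_inv.
  - move=> g h [n _ pg] [m _ ph]; exists (n + m) => //; exact: pow_add.
by move=> g [n _ pg] H [gH SH]; exact: (pow_sub gH SH pg).
Qed.

End Tiles.

Section Nucleus.
Variables (X : finType) (G : set (tree_aut X)).
Hypotheses (gG : subgroup G) (sG : self_similar G) (rG : self_replicating G).
Hypothesis cG : contracting G.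

Local Notation N := (nucleus G).

Lemma nucleus_finite : finite_set N.
Proof. by case: (nucleus_absorbing cG). Qed.

Lemma nucleus_in g : N g -> G g.
Proof. by case: (nucleus_absorbing cG) => _ + _; exact. Qed.

(** The elements of the nucleus all of whose sections stay in the nucleus already form an absorbing
    set, and the nucleus is the smallest one. *)
Lemma nucleus_section g v : N g -> N (section g v).
Proof.
have [fN NG aN] := nucleus_absorbing cG.
suff : absorbing G [set s | N s /\ forall v, N (section s v)].
  by move=> /nucleus_sub h /h [_ ]; exact.
split; first by apply: sub_finite_set fN => s [].
  by move=> s [/NG].
move=> h Gh; have [m hm] := aN h Gh; exists m => w mw; split; first exact: hm.
by move=> w'; rewrite -section_cat; apply: hm; rewrite size_cat (leq_trans mw) ?leq_addr.
Qed.

Lemma finite_absorbed (E : set (tree_aut X)) : finite_set E -> E `<=` G ->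
  exists m, forall g v, E g -> m <= size v -> N (section g v).
Proof.
have [fN NG aN] := nucleus_absorbing cG => fE EG.
have bA g : exists m, E g -> forall v, m <= size v -> N (section g v).
  have [Ag|nAg] := pselect (E g); last by exists 0 => /nAg.
  by have [m hm] := aN g (EG _ Ag); exists m.
have [b hb] := choice bA.
exists (\max_(g <- fset_set E) b g) => g v Eg le.
apply: (hb _ Eg); apply: leq_trans le.
by apply: leq_bigmax_seq => //; rewrite in_fset_set// inE.
Qed.

Lemma self_replicating_lift (u v : seq X) h : size u = size v -> G h ->
  exists g, [/\ G g, g u = v & section g u = h].
Proof.
have [tr rep] := rG.
elim: u v h => [|x u IH] [|y v] h //= => [_ Gh|[uv] Gh].
  by exists h; rewrite tree_aut_root section_nil.
have [g' [Gg' g'u sg'u]] := IH v h uv Gh.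
have [g1 [Gg1 g1x sg1]] := rep x g' Gg'.
have [a Ga ax] := tr x y.
(* [c] fixes [x] and has there the inverse of the section of [a], so [a * c] takes [x] to [y] with
   trivial section. *)
have [c [Gc cx sc]] := rep x _ (subgroupV gG (sG [:: x] Ga)).
have kx : (a * c * g1)%g [:: x] = [:: y] by rewrite /= g1x cx.
have sk : section (a * c * g1)%g [:: x] = g'.
  by rewrite sectionM g1x sg1 sectionM cx sc mulgV mul1g.
exists (a * c * g1)%g; split; first by do 2?apply: subgroupM.
- by rewrite -cat1s sectionE kx sk g'u.
- by rewrite -cat1s section_cat sk.
Qed.

(** Sections of the generators at words of some length [m] lie in the nucleus. Elements whose
    sections at these words are products of nucleus elements form a subgroup, which thus contains
    [G]; by self-replication every element of [G] is such a section. *)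
Lemma nucleus_pow (S : set (tree_aut X)) (x : X) :
  finite_set S -> generates S G -> G = \bigcup_n pow N n.
Proof.
move=> fS gS; apply/seteqP; split => [h Gh|g [n _]]; last first.
  by apply: (pow_sub gG); exact: nucleus_in.
have SG : S `<=` G by rewrite -gS; exact: sub_gen_smallest.
have [m hm] := finite_absorbed fS SG.
pose H : set (tree_aut X) := \bigcup_n pow N n.
pose P : set (tree_aut X) :=
  [set g | forall v, size v = m -> H (section g v)].
have gP : subgroup P.
  apply: subgroup_ofP.
  - by move=> v _; rewrite section1; exists 0.
  - move=> g Pg v vm; rewrite -(tree_autVK g v) sectionV.
    have [|n _ pn] := Pg (tree_aut_inv g v).
      by rewrite -vm -[in LHS](size_tree_aut g) tree_autVK.
    by exists n => //; apply: pow_inv pn; exact: nucleusV.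
  - move=> g k Pg Pk v vm; rewrite sectionM.
    have [|n _ pn] := Pg (k v); first by rewrite size_tree_aut.
    have [n' _ pn'] := Pk v vm.
    by exists (n + n') => //; exact: pow_add.
have GP : G `<=` P.
  rewrite -[in X in X `<=` _]gS; apply: smallest_sub => // s Ss v vm.
  by exists 1 => //; apply: pow1; apply: hm => //; rewrite vm.
have [g [Gg _ <-]] := @self_replicating_lift (nseq m x) (nseq m x) h erefl Gh.
by apply: GP => //; rewrite size_nseq.
Qed.

End Nucleus.

(** * Ultrafilter limits *)

Inductive linked (T : Type) (A : set T) (E : T -> T -> Prop) (x : T) : T -> Prop :=
| linked_refl : A x -> linked A E x x
| linked_step y z : linked A E x y -> E y z -> A z -> linked A E x z.

Section Linked.
Variables (T : Type) (A : set T) (E : T -> T -> Prop).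

Lemma linked_end x y : linked A E x y -> A y.
Proof. by case. Qed.

Lemma linked_start x y : linked A E x y -> A x.
Proof. by elim. Qed.

Lemma linked_trans x y z : linked A E x y -> linked A E y z -> linked A E x z.
Proof. by move=> xy; elim=> // y' z' _ IH E' Az'; exact: linked_step IH _ _. Qed.

Lemma linked_sym x y : (forall a b, E a b -> E b a) ->
  linked A E x y -> linked A E y x.
Proof.
move=> Es; elim=> [Ax|y' z' xy' IH Eyz Az]; first exact: linked_refl.
apply: linked_trans IH; apply: linked_step (Es _ _ Eyz) (linked_end xy').
exact: linked_refl.
Qed.

End Linked.

Section UltraLimits.
Variable w : set_system nat.
Hypotheses (uw : UltraFilter w) (w_oo : \oo `<=` w).

Lemma ultra_ge k : w [set n | k <= n].
Proof. by apply: w_oo; exact: nbhs_infty_ge. Qed.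

Lemma ultraN (A : set nat) : ~ w A -> w (~` A).
Proof. by move=> nA; have [] := in_ultra_setVsetC A uw. Qed.

(** An ultrafilter picks one class of a finite partition. This pigeonhole principle takes the place
    of passing to subsequences. *)
Lemma ultra_finite (T : choiceType) (A : set T) (f : nat -> T) : finite_set A ->
  w [set n | A (f n)] -> exists2 a, A a & w [set n | f n = a].
Proof.
move=> /finite_seqP[s ->]; elim: s => [|a s IH] wA.
  by have [n] := filter_ex wA.
have [wa|/ultraN wna] := pselect (w [set n | f n = a]).
  by exists a => //=; rewrite mem_head.
have [|b sb wb] := IH; last by exists b => //=; rewrite inE sb orbT.
apply: filterS2 wA wna => n /=; rewrite inE => /orP[/eqP //|//].
Qed.

Lemma ultra_exists (T : choiceType) (A : set T) (P : nat -> T -> Prop) :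
  finite_set A -> w [set n | exists2 a, A a & P n a] ->
  exists2 a, A a & w [set n | P n a].
Proof.
move=> fA wA; have [[a0 Aa0]|A0] := pselect (A !=set0); last first.
  by have [n [a Aa]] := filter_ex wA; case: A0; exists a.
have f_ n : exists a, (exists2 a, A a & P n a) -> A a /\ P n a.
  by have [[a Aa Pa]|nP] := pselect (exists2 a, A a & P n a); [exists a|exists a0].
have [f hf] := choice f_.
have [|a Aa wa] := @ultra_finite _ A f fA.
  by apply: filterS wA => n /hf[].
exists a => //; apply: filterS2 wA wa => n /= /hf[_ +] fa.
by rewrite fa.
Qed.

End UltraLimits.

Section Points.
Variables (X : finType) (G : set (tree_aut X)).

(** The sequence is indexed from 0, so this is x_n ... x_1; the reversal puts the letter added at
    the next level in front. *)
Definition word (x : nat -> X) n : seq X := rev (mkseq x n).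

Lemma size_word x n : size (word x n) = n.
Proof. by rewrite size_rev size_mkseq. Qed.

Lemma wordS x n : word x n.+1 = x n :: word x n.
Proof. by rewrite /word mkseqS rev_rcons. Qed.

Lemma word_add x m n :
  exists2 u, size u = m & word x (m + n) = u ++ word x n.
Proof.
elim: m => [|m [u um E]]; first by exists [::].
by exists (x (m + n) :: u); rewrite /= ?um// addSn wordS E.
Qed.

Lemma word_nth x0 (u : seq X) : word (nth x0 (rev u)) (size u) = u.
Proof. by rewrite /word -size_rev mkseq_nth revK. Qed.

Definition tile_of n (p : left_words_group G) : seq X * tree_aut X :=
  (word p.1 n, \val p.2).

Lemma tile_of_in n p : G (tile_of n p).2.
Proof. by rewrite /tile_of /=; exact: set_valP. Qed.

Lemma tile_of_add m n p :
  exists2 u, size u = m & tile_of (m + n) p = extend u (tile_of n p).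
Proof. by have [u um E] := word_add p.1 m n; exists u; rewrite // /tile_of E. Qed.

Lemma extend_inj (u u' : seq X) (t t' : seq X * tree_aut X) :
  size u = size u' -> extend u t = extend u' t' -> u = u' /\ t = t'.
Proof.
move=> uu' [/eqP]; rewrite eqseq_cat// => /andP[/eqP-> /eqP E1] E2.
by case: t t' E1 E2 {uu'} => [? ?] [? ?] /= -> ->.
Qed.

Lemma tile_of_surj (x0 : X) t : G t.2 -> exists p, tile_of (size t.1) p = t.
Proof.
move=> Gt; exists ((nth x0 (rev t.1) : left_words X), SigSub (mem_set Gt)).
by rewrite /tile_of /= word_nth; case: t Gt.
Qed.

Lemma tile_of_le m n p q : m <= n ->
  tile_of n p = tile_of n q -> tile_of m p = tile_of m q.
Proof.
move=> /subnK <-; have [u um ->] := tile_of_add (n - m) m p.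
have [u' um' ->] := tile_of_add (n - m) m q.
by move=> /extend_inj[]//; rewrite um um'.
Qed.

(** Compactness of the left-infinite words times a finite set of group elements: the limit is taken
    letter by letter along the ultrafilter. *)
Lemma point_limit (w : set_system nat) (B : set (tree_aut X))
    (q_ : nat -> left_words_group G) :
  UltraFilter w -> finite_set B -> w [set n | B (\val (q_ n).2)] ->
  exists z, forall l, w [set n | tile_of l (q_ n) = tile_of l z].
Proof.
move=> uw fB wB; have [g _ wg] := ultra_finite uw fB wB.
have [n0 /= n0g] := filter_ex wg.
have x_ l : exists x, w [set n | (q_ n).1 l = x].
  have [||x _ wx] := @ultra_finite w uw X setT (fun n => (q_ n).1 l).
  - exact: finite_finset.
  - exact: filterS filterT.
  - by exists x.
have [x hx] := choice x_.
exists ((x : left_words X), (q_ n0).2) => l.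
suff : w [set n | word (q_ n).1 l = word x l].
  move=> H; apply: filterS2 H wg => n /= Ew Eg.
  by congr pair; [exact: Ew|exact: etrans Eg (esym n0g)].
elim: l => [|l IH]; first by apply: filterS filterT.
by apply: filterS2 IH (hx l) => n /=; rewrite !wordS => -> ->.
Qed.

End Points.

(** * Adjacency of tiles *)

Section Adjacency.
Variables (X : finType) (G : set (tree_aut X)).
Hypotheses (gG : subgroup G) (cG : contracting G).

Local Notation N := (nucleus G).
Implicit Types p q r : left_words_group G.

(* The tiles of level [n] of [p] and [q] meet in the limit space. *)
Definition adj n p q := exists2 s, N s & tile_of n q = act_tile s (tile_of n p).

Lemma tile_of_eq_adj n p q : tile_of n p = tile_of n q -> adj n p q.
Proof.
move=> E; exists 1%g; first exact: (nucleus1 gG cG (p.1 0)).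
by rewrite act_tile1.
Qed.

Lemma adj_refl n p : adj n p p.
Proof. exact: tile_of_eq_adj. Qed.

Lemma adj_sym n p q : adj n p q -> adj n q p.
Proof.
move=> [s Ns E]; exists s^-1%g; first exact: nucleusV.
exact: act_tileK (esym E).
Qed.

Lemma tile_of_act m n p q g :
  tile_of (m + n) q = act_tile g (tile_of (m + n) p) ->
  exists2 u, size u = m & tile_of n q = act_tile (section g u) (tile_of n p).
Proof.
have [u um ->] := tile_of_add m n p; have [v vm ->] := tile_of_add m n q.
rewrite act_tile_extend => /extend_inj[]; first by rewrite size_tree_aut um.
by move=> _ ->; exists u.
Qed.

Lemma adj_le m n p q : m <= n -> adj n p q -> adj m p q.
Proof.
move=> /subnK <- [s Ns /tile_of_act[u _ E]].
by exists (section s u) => //; exact: nucleus_section.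
Qed.

(** By contraction, the sections of a finite set at words of length [m] lie in the nucleus: a
    bounded move becomes an adjacency once [m] levels are forgotten. *)
Lemma adj_of_act (E : set (tree_aut X)) : finite_set E -> E `<=` G ->
  exists m, forall n p q g, E g ->
    tile_of (m + n) q = act_tile g (tile_of (m + n) p) -> adj n p q.
Proof.
move=> fE EG; have [m hm] := finite_absorbed cG fE EG.
exists m => n p q g Eg /tile_of_act[u um Eu]; exists (section g u) => //.
by apply: hm; rewrite ?um.
Qed.

(** Products of two nucleus elements form a finite set, so [adj_of_act] applies. This serves as the
    triangle inequality of the adjacency uniformity. *)
Lemma adj_trans : exists m, forall n p q r,
  adj (m + n) p q -> adj (m + n) q r -> adj n p r.
Proof.
have [|g|m hm] := @adj_of_act (pow N 2); first by exact/finite_pow/nucleus_finite.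
  by apply: (pow_sub gG) => s; exact: nucleus_in.
exists m => n p q r [s Ns E1] [s' Ns' E2]; apply: (hm _ _ _ (s' * s)%g).
  by exists s' => //; exists s => //; exists s => //; exists 1%g; rewrite ?mulg1.
by rewrite act_tileM -E1.
Qed.

Lemma adj_in n p q : adj n p q ->
  exists2 s, N s & \val q.2 = (s * \val p.2)%g.
Proof.
move=> /(adj_le (leq0n n))[s Ns [_]]; rewrite section_nil => E.
by exists s.
Qed.

(** For the converse, adjacencies at high levels are restricted to level [k]; the restrictions range
    over the finite nucleus and converge along an ultrafilter to a coherent sequence. *)
Lemma asymp_adj p q : asymp_equivalent p q <-> forall n, adj n p q.
Proof.
split=> [[s [Ns sE s0]] n|pq].
  exists (s n) => //; elim: n => [|n IH].
    by rewrite /tile_of /word /act_tile /= section_nil s0 tree_aut_root.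
  rewrite /tile_of !wordS -/(tile_of n q); have [sx ss] := sE n.
  rewrite -cat1s -[p.1 n :: _]cat1s -sx.
  have := act_tile_extend (s n.+1) [:: p.1 n] (tile_of n p).
  by rewrite ss -IH => ->.
have [w [uw w_oo]] := ultraFilterLemma (eventually_filter).
have /choice[a ha] : forall n, exists a, N a /\ tile_of n q = act_tile a (tile_of n p).
  by move=> n; have [a Na E] := pq n; exists a.
(* [pre n k] is x_n ... x_(k+1), so the section [b k n] of [a n] there acts on the tile of level
   [k]. *)
pose pre n k := take (n - k) (word p.1 n).
have preS n k : k < n -> pre n k = rcons (pre n k.+1) (p.1 k).
  move=> kn; have [u um E] := word_add p.1 (n - k.+1) k.+1.
  rewrite /pre; rewrite (subnK kn) in E; rewrite E wordS.
  rewrite [in RHS]take_size_cat ?um// -cat_rcons.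
  by rewrite take_size_cat// size_rcons um subnSK.
pose b k n := section (a n) (pre n k).
have Nb k n : N (b k n) by apply: nucleus_section => //; have [] := ha n.
have bE n k : k <= n -> tile_of k q = act_tile (b k n) (tile_of k p).
  move=> kn; have [_] := ha n; have [u um E] := word_add p.1 (n - k) k.
  rewrite (subnK kn) in E; rewrite -{1 2}(subnK kn).
  have [v vm ->] := tile_of_add (n - k) k q.
  rewrite /tile_of (subnK kn) E -/(tile_of k p) -/(extend u (tile_of k p)).
  rewrite act_tile_extend => /extend_inj[]; first by rewrite size_tree_aut um.
  by move=> _ ->; rewrite /b /pre E take_size_cat.
have /choice[s hs] : forall k, exists s, w [set n | b k n = s].
  move=> k; have [|s _ ws] := @ultra_finite w uw _ N (b k) (nucleus_finite cG).
    apply: filterS filterT => n _ /=; exact: Nb.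
  by exists s.
exists s; split=> [n|n|].
- by have [m /= <-] := filter_ex (hs n).
- have wn := ultra_ge w_oo n.+1.
  have [m [/= [bn bn1] nm]] := filter_ex (filterI (filterI (hs n) (hs n.+1)) wn).
  rewrite -bn -bn1; have := bE _ _ nm; rewrite /tile_of !wordS.
  rewrite -cat1s -[p.1 n :: _]cat1s -!/(extend _ (word _ n, _)).
  rewrite act_tile_extend => /extend_inj[]; first by rewrite size_tree_aut.
  by move=> <- _; rewrite /b (preS _ _ nm) -cats1 section_cat.
- have [m /= bm] := filter_ex (hs 0); rewrite -bm.
  by have [_] := bE m 0 (leq0n m); rewrite /word /= section_nil.
Qed.

End Adjacency.

(** * Connected refinements of sets of tiles *)

Section Refinement.
Variable X : finType.
Variables (N L : set (tree_aut X)) (v0 : seq X).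
Hypothesis L1 : L 1%g.

Definition tile_adj (t t' : seq X * tree_aut X) := exists2 s, N s & t' = act_tile s t.

(* Each tile is replaced by the [L]-translates of one of its children.  For
   suitable [L] these include all the children, and link them to those of the
   adjacent tiles. *)
Definition refine (D : set (seq X * tree_aut X)) : set (seq X * tree_aut X) :=
  [set act_tile l (extend v0 t) | l in L & t in D].

(** The section at [v0] brings [b * l] back into [B], so the displacement from [D] does not
    accumulate over the refinements. *)
Lemma refine_bound (B : set (tree_aut X)) :
  B 1%g -> (forall b l, B b -> L l -> B (section (b * l)%g v0)) ->
  forall i D t, iter i refine D t ->
  exists u b t0, [/\ size u = i * size v0, B b, D t0 & t = extend u (act_tile b t0)].
Proof.
move=> B1 BL i; elim: i => [|i IH] D t.
  by move=> Dt; exists [::], 1%g, t; rewrite act_tile1; case: t Dt.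
rewrite iterSr => /IH[u [b [_ [ui Bb [l Ll [t0 Dt0 <-]] ->]]]].
exists (u ++ (b * l)%g v0), (section (b * l)%g v0), t0; split => //.
- by rewrite size_cat ui size_tree_aut mulSn addnC.
- exact: BL.
- by rewrite -act_tileM act_tile_extend extend_cat.
Qed.

Lemma refine_child D u t : (exists l, [/\ L l, l v0 = u & section l v0 = 1%g]) ->
  D t -> refine D (extend u t).
Proof.
move=> [l [Ll lu sl]] Dt; exists l => //; exists t => //.
by rewrite act_tile_extend lu sl act_tile1.
Qed.

Hypothesis N_sym : forall s, N s -> N s^-1%g.
Hypothesis L_linked :
  forall l, L l -> linked L (fun a b => exists2 s, N s & b = (s * a)%g) 1%g l.
Hypothesis N_lift :
  forall s, N s -> exists l, [/\ L l, l v0 = v0 & section l v0 = s].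

Lemma tile_adj_sym t t' : tile_adj t t' -> tile_adj t' t.
Proof.
move=> [s Ns E]; exists s^-1%g; first exact: N_sym.
exact: act_tileK (esym E).
Qed.

Definition tile_connected (D : set (seq X * tree_aut X)) :=
  forall t t', D t -> D t' -> linked D tile_adj t t'.

(** [L_linked] joins the child [extend v0 t] to its translates, and [N_lift] shows that the child of
    an adjacent tile is one of these translates. *)
Lemma refine_connected D : tile_connected D -> tile_connected (refine D).
Proof.
move=> cD.
have toL t l : D t -> L l ->
    linked (refine D) tile_adj (extend v0 t) (act_tile l (extend v0 t)).
  move=> Dt /L_linked; elim => [_|a b _ IH [s Ns ->] Lb].
    by rewrite act_tile1; apply: linked_refl; exists 1%g => //; exists t;
      rewrite ?act_tile1.
  apply: linked_step IH _ _; first by exists s; rewrite ?act_tileM.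
  by exists (s * a)%g => //; exists t.
have base t t' : D t -> D t' ->
    linked (refine D) tile_adj (extend v0 t) (extend v0 t').
  move=> Dt Dt'; elim: (cD _ _ Dt Dt') => [_|a b ab IH [s Ns Eb] Db].
    exact: linked_refl (linked_start (toL t _ Dt L1)).
  apply: linked_trans IH _; have [l [Ll lv sl]] := N_lift Ns.
  have := toL a l (linked_end ab) Ll.
  by rewrite act_tile_extend lv sl Eb.
move=> _ _ [l Ll [t Dt <-]] [l' Ll' [t' Dt' <-]].
apply: linked_trans (toL _ _ Dt' Ll').
apply: linked_trans (base _ _ Dt Dt').
by apply: linked_sym (toL _ _ Dt Ll) => a b; exact: tile_adj_sym.
Qed.

Lemma iter_refine_connected i D : tile_connected D -> tile_connected (iter i refine D).
Proof. by move=> cD; elim: i => //= i IH; exact: refine_connected. Qed.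

End Refinement.

Section Chains.
Variables (X : finType) (G : set (tree_aut X)).
Hypotheses (gG : subgroup G) (sG : self_similar G) (rG : self_replicating G).
Hypothesis cG : contracting G.
Local Notation N := (nucleus G).
Hypothesis NG : G = \bigcup_n pow N n.
Variable x0 : X.
Implicit Types p q r : left_words_group G.

Let N1 : N 1%g := nucleus1 gG cG x0.

Lemma pow_nucleus_bound (E : set (tree_aut X)) : finite_set E -> E `<=` G ->
  exists n, E `<=` pow N n.
Proof.
move=> fE EG.
have [b hb] : exists b : tree_aut X -> nat, forall g, E g -> pow N (b g) g.
  have H g : exists n, E g -> pow N n g.
    have [/EG|nE] := pselect (E g); last by exists 0 => /nE.
    by rewrite [in X in X -> _]NG => -[n _ ?]; exists n.
  by have [b hb] := choice H; exists b.
exists (\max_(g <- fset_set E) b g) => g Eg.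
apply: pow_le (hb _ Eg) => //.
by apply: leq_bigmax_seq => //; rewrite in_fset_set// inE.
Qed.

Lemma pow_linked n l : pow N n l ->
  linked (pow N n) (fun a b => exists2 s, N s & b = (s * a)%g) 1%g l.
Proof.
elim: n l => [|n IH] l /=; first by move=> ->; exact: linked_refl.
move=> [s Ns [h /IH ph <-]].
have sub : pow N n `<=` pow N n.+1 by exact: pow_le.
apply: (@linked_step _ _ _ _ h); last by exists s => //; exists h => //; exact: linked_end ph.
  elim: ph => [p1|a b _ IHl E pb]; first by apply: linked_refl; exact: sub.
  by apply: linked_step IHl E _; exact: sub.
by exists s.
Qed.

(** The product is read in pairs of nucleus elements, and each pair has its section in the
    nucleus. *)
Lemma section_pow_half m :
  (forall g h v, N g -> N h -> m <= size v -> N (section (g * h)%g v)) ->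
  forall n g v, m <= size v -> pow N (n + n) g -> pow N n (section g v).
Proof.
move=> hm; elim=> [|n IH] g v mv /=; first by move=> ->; rewrite section1.
rewrite addnS => -[s Ns [_ [s' Ns' [h ph <-]] <-]].
rewrite mulgA sectionM; exists (section (s * s')%g (h v)).
  by apply: hm => //; rewrite size_tree_aut.
by exists (section h v) => //; exact: IH.
Qed.

(** Uniform local connectedness in combinatorial form: one set [K] is chain connected at every
    resolution [k]. It consists of the points that fall in some iterated refinement of the star of
    the tile of [p]. *)
Lemma chain_nbhd : exists c, forall n p, exists K : set (left_words_group G),
  [/\ forall q, adj (c + n) p q -> K q, forall q, K q -> adj n p q &
      forall k q, K q -> linked K (adj k) p q].
Proof.
have [m hm] := nucleusM_absorbed gG cG.
(* Length at least [m] makes sections contract; the extra letter makes each refinement gain a level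
   even if [m] is 0. *)
pose v0 := nseq m.+1 x0.
have lift u s : exists g, [/\ G g, size u = m.+1 -> g v0 = u &
    G s -> size u = m.+1 -> section g v0 = s].
  have [um|] := pselect (size u = m.+1); last first.
    by move=> nu; exists 1%g; split => //; exact: subgroup1.
  have [Gs|nGs] := pselect (G s); last first.
    have [|g [Gg gu _]] := self_replicating_lift gG sG rG _ (subgroup1 gG) (u := v0) (v := u).
      by rewrite size_nseq.
    by exists g; split.
  have [|g [Gg gu gs]] := self_replicating_lift gG sG rG _ Gs (u := v0) (v := u).
    by rewrite size_nseq.
  by exists g; split.
have /choice[f hf] : forall us : seq X * tree_aut X, exists g,
    [/\ G g, size us.1 = m.+1 -> g v0 = us.1 &
    G us.2 -> size us.1 = m.+1 -> section g v0 = us.2] by move=> us; exact: lift.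
(* [E1] takes [v0] to every child with trivial section, and [E2] lifts the nucleus to the stabilizer
   of [v0]; [L] will be a ball containing both. *)
pose E1 : set (tree_aut X) := [set f (tval u, 1%g) | u in [set: m.+1.-tuple X]].
pose E2 : set (tree_aut X) := [set f (v0, s) | s in N].
have [j hj] : exists j, E1 `|` E2 `<=` pow N j.
  apply: pow_nucleus_bound.
    rewrite finite_setU; split; apply: finite_image; first exact: finite_finset.
    exact: nucleus_finite.
  by move=> _ [[u _ <-]|[s _ <-]]; [case: (hf (tval u, 1%g))|case: (hf (v0, s))].
pose L := pow N j.
have L1 : L 1%g by exact: (@pow_le _ _ 0 j N1 (leq0n j)).
have fL : finite_set L by apply: finite_pow; exact: nucleus_finite.
have [c hc] := @adj_of_act _ G cG (pow N (j + 1)) (finite_pow _ (nucleus_finite cG))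
  (pow_sub gG (@nucleus_in _ _ cG)).
have LB b l : L b -> L l -> L (section (b * l)%g v0).
  move=> Lb Ll; apply: (section_pow_half hm); first by rewrite size_nseq.
  exact: pow_add.
(* Sections at [v0] halve the length with respect to the nucleus, so the
   refinements of the tiles adjacent to that of [p] do not spread. *)
exists c => n p.
pose D0 : set (seq X * tree_aut X) := [set act_tile s (tile_of (c + n) p) | s in N].
pose D i := iter i (refine L v0) D0.
pose K : set (left_words_group G) := [set q | exists i, D i (tile_of (i * m.+1 + (c + n)) q)].
have child i q : D i (tile_of (i * m.+1 + (c + n)) q) ->
    D i.+1 (tile_of (i.+1 * m.+1 + (c + n)) q).
  move=> Dq; rewrite mulSn -addnA.
  have [u um ->] := tile_of_add m.+1 (i * m.+1 + (c + n)) q.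
  apply: refine_child => //; have [Gg gu gs] := hf (u, 1%g).
  exists (f (u, 1%g)); split.
  - by apply: hj; left; have /eqP um' := um; exists (Tuple um').
  - exact: gu um.
  - exact: gs (subgroup1 gG) um.
have childs i k q : D i (tile_of (i * m.+1 + (c + n)) q) ->
    D (k + i) (tile_of ((k + i) * m.+1 + (c + n)) q).
  by move=> Dq; elim: k => // k IH; rewrite addSn; exact: child.
have Dadj i q : D i (tile_of (i * m.+1 + (c + n)) q) -> adj n p q.
  move=> /(refine_bound L1 LB)[u [b [_ [ui Lb [s Ns <-] E]]]].
  apply: (hc _ _ _ (b * s)%g); first by apply: pow_add => //; exact: pow1.
  rewrite act_tileM; have [v vm Eq] := tile_of_add (i * m.+1) (c + n) q.
  rewrite Eq in E; have [] // := extend_inj _ E.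
  by rewrite vm ui size_nseq.
have DG i t : D i t -> size t.1 = i * m.+1 + (c + n) /\ G t.2.
  move=> /(refine_bound L1 LB)[u [b [_ [ui Lb [s Ns <-] ->]]]]; split.
    by rewrite /= size_cat ui !size_tree_aut size_word size_nseq.
  apply: subgroupM => //; first by apply/sG/(pow_sub gG (@nucleus_in _ _ cG) Lb).
  apply: subgroupM => //; first by apply/sG/(nucleus_in cG).
  exact: tile_of_in.
have D0p : D 0 (tile_of (0 * m.+1 + (c + n)) p).
  by exists 1%g => //; rewrite act_tile1.
have D0c : tile_connected N (D 0).
  have H s : N s -> linked (D 0) (tile_adj N) (tile_of (c + n) p)
      (act_tile s (tile_of (c + n) p)).
    move=> Ns; apply: linked_step (linked_refl _ _) _ _; first exact: D0p.
      by exists s.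
    by exists s.
  move=> _ _ [s Ns <-] [s' Ns' <-]; apply: linked_trans (H _ Ns').
  by apply: linked_sym (H _ Ns) => a b; apply: tile_adj_sym => ?; exact: nucleusV.
have Dc i : tile_connected N (D i).
  apply: iter_refine_connected => //.
  - by move=> s; exact: nucleusV.
  - by move=> l; exact: pow_linked.
  - move=> s Ns; exists (f (v0, s)); have [Gg gu gs] := hf (v0, s).
    split; [by apply: hj; right; exists s|apply: gu|apply: gs]; rewrite ?size_nseq//.
    exact: (nucleus_in cG).
exists K; split.
- move=> q [s Ns E]; exists 0; exists s => //.
- by move=> q [i /Dadj].
- move=> k q [i Di].
  (* A refinement of level at least [k] contains tiles of both points, and a chain of tiles there is
     a chain at level [k]. *)
  have Dq := childs i k q Di; have Dp' := childs 0 (k + i) p D0p.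
  rewrite addn0 in Dp'.
  have kle : k <= (k + i) * m.+1 + (c + n).
    by rewrite (leq_trans _ (leq_addr _ _))// mulnS -addnA leq_addr.
  move: {i Di} (k + i) kle Dq Dp' => i kle Dq Dp'.
  have pt t : D i t -> exists q, tile_of (i * m.+1 + (c + n)) q = t.
    by move=> /DG[<- Gt]; exact: tile_of_surj.
  have [z Ez zq] : exists2 z, tile_of (i * m.+1 + (c + n)) z =
      tile_of (i * m.+1 + (c + n)) q & linked K (adj k) p z.
    elim: (Dc i _ _ Dp' Dq) => [_|a b _ [z za pz] [s Ns Eb] Db].
      by exists p => //; apply: linked_refl; exists i.
    have [z' z'b] := pt _ Db; exists z' => //; apply: linked_step pz _ _.
      by apply: (adj_le cG kle); exists s => //; rewrite z'b Eb za.
    by exists i; rewrite z'b.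
  apply: linked_step zq _ _; last by exists i.
  by apply: (adj_le cG kle); apply: tile_of_eq_adj.
Qed.

End Chains.

(** * The topology of the limit space *)

Lemma nbhs_prefix (X : finType)
    (x : prod_topology (fun _ : nat => discrete_topology X)) A :
  nbhs x A <-> exists n, forall y, mkseq y n = mkseq x n -> A y.
Proof.
have xF : Filter (nbhs x) by exact: nbhs_filter.
split=> [xA|[n hn]]; last first.
  apply: (filterS (P := [set y | mkseq y n = mkseq x n])) => //.
  elim: n {hn} => [|n IH]; first by apply: (@filterS _ (nbhs x) xF setT) => //; exact: filterT.
  have xn : nbhs x [set y : prod_topology _ | y n = x n].
    by apply: (@proj_continuous _ (fun=> discrete_topology X) n x [set x n]).
  by apply: filterS2 IH xn => y /=; rewrite !mkseqS => -> ->.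
pose F : set_system (prod_topology (fun _ : nat => discrete_topology X)) :=
  [set A | exists n, forall y, mkseq y n = mkseq x n -> A y].
have mle m n (y : nat -> X) : m <= n -> mkseq y n = mkseq x n -> mkseq y m = mkseq x m.
  by move=> mn E; rewrite -(subnKC mn) in E; move/(congr1 (take m)): E;
     rewrite -!map_take !take_iota (minn_idPl (leq_addr _ _)).
have FF : Filter F.
  split; first by exists 0.
  - move=> P Q [n hn] [m hm]; exists (maxn n m) => y E.
    by split; [apply: hn; apply: mle E; rewrite leq_maxl|apply: hm; apply: mle E; rewrite leq_maxr].
  - by move=> P Q PQ [n hn]; exists n => y /hn /PQ.
suff : F --> x by exact.
apply/cvg_sup => i B [C [[D oD <-] Dx] sub].
exists i.+1 => y E; apply: sub => /=.
suff -> : y i = x i by [].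
by move: E; rewrite !mkseqS => /rcons_inj[].
Qed.

Section LimitSpace.
Variables (X : finType) (G : set (tree_aut X)).
Hypotheses (gG : subgroup G) (cG : contracting G).
Implicit Types p q r : left_words_group G.

Lemma nbhs_tile p A : nbhs p A <-> exists n, forall q, tile_of n q = tile_of n p -> A q.
Proof.
case: p => x g; split=> [[[/= P Q] [/nbhs_prefix[n hn] Qg] sub]|[n hn]].
  exists n => -[y k] [E1 E2]; apply: sub; split => /=.
    by apply: hn; apply: (can_inj revK).
  have -> : k = g by exact: val_inj.
  exact: nbhs_singleton Qg.
exists ([set y | mkseq y n = mkseq x n], [set g]); first split => //=.
  by apply/nbhs_prefix; exists n.
by move=> [y k] /= [E ->]; apply: hn; rewrite /tile_of /word E.
Qed.

Definition limit_pi p : limit_space gG cG :=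
  \pi_(quotient_topology {eq_quot (limit_equiv gG cG)})%qT p.

Lemma limit_piP p q : limit_pi p = limit_pi q <-> forall n, adj n p q.
Proof.
rewrite -(asymp_adj cG); split.
  by move=> E; apply/asboolP; apply/(@eqmodP _ (limit_equiv gG cG)).
by move=> /asboolP E; apply/(@eqmodP _ (limit_equiv gG cG)).
Qed.

Lemma limit_pi_surj (z : limit_space gG cG) : exists p, z = limit_pi p.
Proof. by exists (repr z); rewrite /limit_pi reprK. Qed.

Lemma nbhs_limit_pi n p : nbhs (limit_pi p) (limit_pi @` [set q | adj n p q]).
Proof.
have [m hm] := adj_trans gG cG.
(* [W] is the uniform interior of the star of [p]. It is open because raising the level from [k] to
   [m + (m + k)] absorbs both a move within a tile and a change of representative. *)
pose W := [set z : limit_space gG cG | exists k, forall q, z = limit_pi q ->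
  forall q', adj k q q' -> adj n p q'].
rewrite nbhsE; exists W; last first.
  move=> z [k hk]; have [q zq] := limit_pi_surj z.
  by exists q => //; apply: hk zq _ _; exact: adj_refl.
split; last first.
  by exists (m + n) => q /limit_piP pq q' qq'; apply: hm qq'; exact: pq.
rewrite /open /= /quotient_open openE => q [k hk] /=.
apply/nbhs_tile; exists (m + (m + k)) => q1 E.
exists (m + (m + k)) => q2 /limit_piP q12 q3 q23.
apply: (hk q) => //; apply: (hm _ _ q1).
  by apply: (adj_le cG _ (tile_of_eq_adj gG cG (esym E))); rewrite leq_addl.
by apply: (hm _ _ q2) => //; exact: q12.
Qed.

(** Otherwise points [n]-adjacent to [p] but outside [U], one for each [n], accumulate at some [z]
    equivalent to [p]; an open set around that class contains a whole tile of [z], which meets the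
    sequence. *)
Lemma nbhs_limit_piP (U : set (limit_space gG cG)) p :
  nbhs (limit_pi p) U -> exists n, forall q, adj n p q -> U (limit_pi q).
Proof.
rewrite nbhsE => -[W [W_open Wp] WU].
apply: contrapT => nex.
have /choice[q hq] : forall n, exists q, adj n p q /\ ~ U (limit_pi q).
  move=> n; apply: contrapT => nq; apply: nex; exists n => q pq.
  by apply: contrapT => nU; apply: nq; exists q.
have [w [uw w_oo]] := ultraFilterLemma eventually_filter.
have fB : finite_set [set (s * \val p.2)%g | s in nucleus G].
  by apply: finite_image; exact: nucleus_finite.
have [|z hz] := point_limit (q_ := q) uw fB.
  apply: filterS filterT => n _ /=; have [/(adj_in cG)[s Ns ->] _] := hq n.
  by exists s.
have pz : limit_pi p = limit_pi z.
  apply/limit_piP => n.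
  have [k [/= [E kn] _]] := filter_ex (filterI (filterI (hz n) (ultra_ge w_oo n)) filterT).
  have [+ _] := hq k => /(adj_le cG kn) [s Ns E']; exists s => //.
  by rewrite -E.
rewrite pz in Wp; move: W_open; rewrite /open /= /quotient_open openE => W_open.
have /nbhs_tile[n hn] := W_open z Wp.
have [k /= /hn] := filter_ex (hz n).
by move=> /WU; have [_] := hq k.
Qed.

End LimitSpace.

(** * Locally constant functions and components *)

Section Counting.
Variables (T : choiceType) (R : realType).

Lemma card_ge (A : set T) k (g : nat -> T) : finite_set A ->
  (forall i, i < k -> A (g i)) ->
  (forall i j, i < j -> j < k -> g i <> g j) ->
  k <= #|` fset_set A|.
Proof.
move=> fA gA ginj; rewrite -[k in k <= _](size_mkseq g).
apply: uniq_leq_size.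
  rewrite map_inj_in_uniq ?iota_uniq// => i j.
  rewrite !mem_iota !add0n /= => ik jk gij.
  by case: (ltngtP i j) => // ij; [case: (ginj i j)|case: (ginj j i)].
move=> x /mapP[i]; rewrite mem_iota add0n => /andP[_ ik] ->.
by rewrite in_fset_set// inE; exact: gA.
Qed.

Lemma counting_ge (A : set T) k (g : nat -> T) :
  (forall i, i < k -> A (g i)) ->
  (forall i j, i < j -> j < k -> g i <> g j) ->
  (k%:R%:E <= counting A :> \bar R)%E.
Proof.
move=> gA ginj; rewrite /counting; case: ifPn => [/asboolP fA|]; last by rewrite leey.
by rewrite lee_fin ler_nat; exact: (card_ge fA gA).
Qed.

Lemma counting_le (A : set T) k (g : nat -> T) :
  (forall x, A x -> exists2 i, i < k & x = g i) ->
  (counting A <= k%:R%:E :> \bar R)%E.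
Proof.
move=> Ag.
have sub : A `<=` [set` mkseq g k].
  by move=> x /Ag[i ik ->] /=; apply: map_f; rewrite mem_iota.
have fA : finite_set A by apply: sub_finite_set sub _; exact: finite_seq.
rewrite /counting asboolT// lee_fin ler_nat -(size_mkseq g k).
apply: uniq_leq_size; first exact: fset_uniq.
by move=> x; rewrite in_fset_set// inE => /sub.
Qed.

End Counting.

Section LocallyConstant.
Variable T : topologicalType.
Implicit Types (A B : set T) (f : T -> nat).

Definition locally_constant A f :=
  forall x, A x -> nbhs x [set y | A y -> f y = f x].

Lemma connected_locally_constant A f x y :
  connected A -> locally_constant A f -> A x -> A y -> f x = f y.
Proof.
move=> cA lf Ax Ay.
suff : A `&` [set z | f z = f y] = A by move=> /esym E; move: Ax; rewrite E => -[].
apply: cA; first by exists y.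
- exists (interior [set z | A z -> f z = f y]); first exact: open_interior.
  apply/seteqP; split=> z [Az fz]; split => //=.
    by have := lf z Az; rewrite fz.
  exact: (interior_subset fz).
- exists (~` interior [set z | A z -> f z <> f y]).
    exact/open_closedC/open_interior.
  apply/seteqP; split=> z [Az fz]; split => //=.
    by move=> /interior_subset /(_ Az).
  apply: contrapT => nfz; apply: fz.
  by apply: filterS (lf z Az) => t ft At; rewrite ft.
Qed.

Lemma locally_constant_connected A :
  (forall f, locally_constant A f -> forall x y, A x -> A y -> f x = f y) ->
  connected A.
Proof.
move=> H B [b Bb] [C oC BC] [D cD BD].
pose f x := if `[< B x >] then 1 else 0.
have BA : B `<=` A by rewrite BC; exact: subIsetl.
apply/seteqP; split => // x Ax.
suff fE : f b = f x by apply: contrapT => nBx; move: fE; rewrite /f asboolT// asboolF.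
apply: H => //; last exact: BA.
move=> y Ay; have [By|nBy] := pselect (B y).
  have Cy : C y by move: By; rewrite BC => -[].
  apply: filterS (open_nbhs_nbhs (conj oC Cy)) => z Cz Az.
  by rewrite /f !asboolT// BC.
have nDy : (~` D) y by move=> Dy; apply: nBy; rewrite BD.
apply: filterS (open_nbhs_nbhs (conj (closed_openC cD) nDy)) => z nDz Az.
by rewrite /f !asboolF//; rewrite BD => -[].
Qed.

Lemma locally_constant_sub A B f :
  B `<=` A -> locally_constant A f -> locally_constant B f.
Proof. by move=> BA lf x /BA /lf; apply: filterS => y /= h /BA. Qed.

(** A partition of [A] into [k] non-empty relatively clopen pieces, labelled by [f], whose values
    off [A] are arbitrary. *)
Definition splits A k f := [/\ locally_constant A f,
  forall x, A x -> f x < k & forall i, i < k -> exists2 x, A x & f x = i].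

(** A disconnected piece is cut in two, and the half [B] gets the new label [k]. *)
Lemma splitsS A k f i : splits A k f ->
  ~ connected (A `&` [set x | f x = i]) -> exists g, splits A k.+1 g.
Proof.
move=> [lf fk fs]; set P := A `&` _ => /existsNP[B /not_implyP[[b Bb] /not_implyP[[C oC BC]
  /not_implyP[[D cD BD] BP]]]].
have BsP : B `<=` P by rewrite BC; exact: subIsetl.
pose g x := if `[< B x >] then k else f x.
have gB x : B x -> g x = k by move=> Bx; rewrite /g asboolT.
have gN x : ~ B x -> g x = f x by move=> Bx; rewrite /g asboolF.
exists g; split.
- move=> x Ax; have [Bx|nBx] := pselect (B x).
    have Cx : C x by move: Bx; rewrite BC => -[].
    have fx : f x = i by have [] := BsP _ Bx.
    apply: filterS2 (lf x Ax) (open_nbhs_nbhs (conj oC Cx)) => y fy Cy Ay.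
    by rewrite !gB// BC; split => //; split => //=; rewrite fy.
  have [fx|fx] := pselect (f x = i).
    have nDx : (~` D) x by move=> Dx; apply: nBx; rewrite BD; do !split.
    apply: filterS2 (lf x Ax) (open_nbhs_nbhs (conj (closed_openC cD) nDx)) =>
      y fy nDy Ay.
    by rewrite !gN ?fy//; rewrite BD => -[].
  apply: filterS (lf x Ax) => y fy Ay; rewrite !gN ?fy// => /BsP[_ /=].
  by rewrite fy.
- move=> x Ax; have [Bx|nBx] := pselect (B x); first by rewrite gB.
  by rewrite gN// ltnW// ltnS fk.
- move=> j; rewrite ltnS leq_eqVlt => /orP[/eqP ->|jk].
    by exists b; [have [] := BsP b Bb|exact: gB].
  have [ji|ji] := eqVneq j i.
    have [x Px nBx] : exists2 x, P x & ~ B x.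
      apply: contrapT => nex; apply: BP; apply/seteqP; split => // x Px.
      by apply: contrapT => nBx; apply: nex; exists x.
    by exists x; [case: Px|rewrite gN//; case: Px => _ /= ->].
  have [x Ax fx] := fs j jk; exists x => //; rewrite gN// => /BsP[_ /=].
  by rewrite fx => /eqP; rewrite (negPf ji).
Qed.

(** For the largest possible [k], [splitsS] shows that no piece can be cut again. *)
Lemma max_splits A M : (forall k f, splits A k f -> k <= M) ->
  exists k f, splits A k f /\ forall i, connected (A `&` [set x | f x = i]).
Proof.
move=> bM.
pose Q k := `[< exists f, splits A k f >].
have exQ : exists k, Q k.
  have [A0|A0] := pselect (A = set0).
    by exists 0; apply/asboolP; exists (fun=> 0); rewrite A0; split.
  have [a Aa] : A !=set0 by apply/set0P/eqP.
  exists 1; apply/asboolP; exists (fun=> 0); split => //.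
    by move=> x Ax; exact: filterS filterT.
  by case=> // _; exists a.
have bQ k : Q k -> k <= M by move=> /asboolP[f]; exact: bM.
case: (ex_maxnP exQ bQ) => k /asboolP[f sf] kmax.
exists k, f; split => // i; apply: contrapT => nc.
have [g sg] := splitsS sf nc.
by have := kmax k.+1; rewrite ltnn => /(_ (asboolT (ex_intro _ g sg))).
Qed.

Lemma components_ge (R : realType) A k f : splits A k f ->
  (k%:R%:E <= counting (components A) :> \bar R)%E.
Proof.
move=> [lf fk fs].
have /choice[g hg] : forall i, exists C : set T, i < k ->
    components A C /\ forall y, C y -> f y = i.
  move=> i; have [ik|] := boolP (i < k); last by exists set0.
  have [x Ax fx] := fs i ik; exists (connected_component A x) => _.
  split; first by exists x.
  move=> y [B [Bx BA cB] By]; rewrite -fx.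
  exact: (connected_locally_constant cB (locally_constant_sub BA lf)).
apply: (@counting_ge _ _ _ _ g) => [i /hg[]//|i j ij jk gij].
have [[x Ax Cx] fi] := hg i (ltn_trans ij jk); have [_ fj] := hg j jk.
have gx : g i x by rewrite -Cx; exact: connected_component_refl.
have := fi x gx; rewrite (fj x) -?gij// => ji.
by rewrite ji ltnn in ij.
Qed.

Lemma components_le (R : realType) A k f : splits A k f ->
  (forall i, connected (A `&` [set x | f x = i])) ->
  (counting (components A) <= k%:R%:E :> \bar R)%E.
Proof.
move=> [lf fk fs] cf.
apply: (@counting_le _ _ _ _ (fun i => A `&` [set x | f x = i])).
move=> _ [x Ax <-]; exists (f x); first exact: fk.
apply/seteqP; split => [y [B [Bx BA cB] By]|].
  split; first exact: BA.
  exact: (connected_locally_constant cB (locally_constant_sub BA lf)).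
by apply: connected_component_max => //; exact: subIsetl.
Qed.

End LocallyConstant.

Lemma finite_words (X : finType) n : finite_set [set u : seq X | size u = n].
Proof.
have fT : finite_set [set tval u | u in [set: n.-tuple X]].
  by apply: finite_image; exact: finite_finset.
apply: sub_finite_set fT.
by move=> u /= /eqP un; exists (Tuple un).
Qed.

(** * Local connectedness of the limit space *)

Section LocalConnectedness.
Variables (X : finType) (G : set (tree_aut X)).
Hypotheses (gG : subgroup G) (sG : self_similar G) (rG : self_replicating G).
Hypothesis cG : contracting G.
Local Notation N := (nucleus G).
Hypothesis NG : G = \bigcup_n pow N n.
Variable x0 : X.
Implicit Types p q r : left_words_group G.
Local Notation lpi := (limit_pi gG cG).

Lemma adj_tile_l n p p' q : tile_of n p = tile_of n p' -> adj n p q -> adj n p' q.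
Proof. by move=> E [s Ns Eq]; exists s; rewrite -?E. Qed.

Lemma adj_tile_r n p q q' : tile_of n q = tile_of n q' -> adj n p q -> adj n p q'.
Proof. by move=> E [s Ns Eq]; exists s; rewrite -?E. Qed.

Lemma adj_limit (w : set_system nat) n p (q_ : nat -> left_words_group G) :
  UltraFilter w -> w [set l | adj n p (q_ l)] ->
  exists z : left_words_group G, forall l, w [set k | tile_of l (q_ k) = tile_of l z].
Proof.
move=> uw pq.
apply: (@point_limit _ _ _ [set (s * \val p.2)%g | s in N]) => //.
  by apply: finite_image; exact: nucleus_finite.
by apply: filterS pq => l /= /(adj_in cG)[s Ns ->]; exists s.
Qed.

Lemma connected_nbhd : exists c, forall n p, exists C : set (limit_space gG cG),
  [/\ connected C, forall q, adj (c + n) p q -> C (lpi q) &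
      C `<=` lpi @` [set q | adj n p q]].
Proof.
have [m hm] := adj_trans gG cG.
have [c hc] := chain_nbhd gG sG rG cG NG x0.
exists (c + m) => n p; have [K [pK Kp linkK]] := hc (m + n) p.
(* A locally constant function on the closure [K'] of [K] is uniformly so, hence
   constant along the chains of [K]. *)
pose K' := [set q | forall k, exists2 z, K z & adj k q z].
have KK' : K `<=` K' by move=> q Kq k; exists q => //; exact: adj_refl.
have K'p q : K' q -> adj n p q.
  move=> /(_ (m + n))[z /Kp pz /(adj_sym gG cG) zq]; exact: hm pz zq.
exists (lpi @` K'); split.
- apply: locally_constant_connected => f lf.
  have [w [uw w_oo]] := ultraFilterLemma eventually_filter.
  (* If this fails at every level, the offending pairs have a common limit [z] in [K'], where [f] is
     not locally constant. *)
  have [l hl] : exists l, forall z z', K' z -> K' z' -> adj l z z' ->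
      f (lpi z) = f (lpi z').
    apply: contrapT => nex.
    have bad l : exists zz : left_words_group G * left_words_group G,
        [/\ K' zz.1, K' zz.2, adj l zz.1 zz.2 &
        f (lpi zz.1) <> f (lpi zz.2)].
      apply: contrapT => nl; apply: nex; exists l => z z' Kz Kz' zz'.
      by apply: contrapT => nf; apply: nl; exists (z, z').
    have [zz hzz] := choice bad.
    have [|z hz] := @adj_limit w n p (fun l => (zz l).1) uw.
      by apply: filterS filterT => l _ /=; apply: K'p; have [] := hzz l.
    have K'z : K' z.
      move=> k; have [l /= lz] := filter_ex (hz k).
      have [/(_ k)[y Ky zy] _ _ _] := hzz l.
      by exists y => //; exact: adj_tile_l zy.
    have lfz : (lpi @` K') (lpi z) by exists z.
    have [k hk] := nbhs_limit_piP (lf _ lfz).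
    have [l [/= lz ml]] := filter_ex (filterI (hz (m + k)) (ultra_ge w_oo (m + k))).
    have [K1 K2 /(adj_le cG ml) l12] := hzz l.
    have lkz : adj k z (zz l).1.
      apply: tile_of_eq_adj => //; apply/esym; apply: tile_of_le lz.
      by rewrite leq_addl.
    have lkz' : adj k z (zz l).2.
      by apply: hm l12; apply: tile_of_eq_adj.
    have fz1 : f (lpi (zz l).1) = f (lpi z) by apply: hk lkz _; exists (zz l).1.
    have fz2 : f (lpi (zz l).2) = f (lpi z) by apply: hk lkz' _; exists (zz l).2.
    by rewrite fz1 fz2.
  have fp q : K' q -> f (lpi q) = f (lpi p).
    move=> K'q; have [y Ky qy] := K'q l.
    rewrite (hl q y)//; last exact: KK'.
    elim: (linkK l y Ky) => // a b pa IH ab Kb.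
    rewrite -IH; apply/esym/hl => //; apply: KK' => //; exact: linked_end pa.
  by move=> _ _ [q K'q <-] [q' K'q' <-]; rewrite !fp.
- by move=> q pq; exists q => //; apply/KK'/pK; rewrite addnA.
- by move=> _ [q /K'p pq <-]; exists q.
Qed.

End LocalConnectedness.

(** * Pieces of a punctured neighbourhood *)

Section Cuts.
Variables (X : finType) (G : set (tree_aut X)).
Hypotheses (gG : subgroup G) (sG : self_similar G) (rG : self_replicating G).
Hypothesis cG : contracting G.
Local Notation N := (nucleus G).
Hypothesis NG : G = \bigcup_n pow N n.
Variable x0 : X.
Implicit Types p q r : left_words_group G.
Local Notation lpi := (limit_pi gG cG).

Variable m : nat.
Hypothesis hm : forall n p q r, adj (m + n) p q -> adj (m + n) q r -> adj n p r.
Variable c : nat.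
Hypothesis hc : forall n p, exists C : set (limit_space gG cG),
  [/\ connected C, forall q, adj (c + n) p q -> C (lpi q) &
      C `<=` lpi @` [set q | adj n p q]].

Variables (p : left_words_group G) (U : set (limit_space gG cG)) (k : nat).
Variable f : limit_space gG cG -> nat.
Hypothesis sf : splits (U `\ lpi p) k f.
Variable n0 : nat.
Hypothesis hn0 : forall q, adj n0 p q -> U (lpi q).

(** If the [i]-th piece stayed away from the puncture, its indicator, extended by 0, would be
    locally constant on the connected set [U] without being constant. *)
Lemma cut_clusters i n : nbhs (lpi p) U -> connected U -> i < k ->
  exists q, [/\ adj n p q, lpi q <> lpi p, U (lpi q) & f (lpi q) = i].
Proof.
move=> pU cU ik; apply: contrapT => nex; have [lf fk /(_ i ik)[y [Uy yp] fy]] := sf.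
pose g (z : limit_space gG cG) := if `[< z = lpi p >] then k else f z.
pose h (z : limit_space gG cG) := if g z == i then 1 else 0.
have gp : g (lpi p) = k by rewrite /g asboolT.
have gN z : z <> lpi p -> g z = f z by move=> zp; rewrite /g asboolF.
suff lh : locally_constant U h.
  have Up : U (lpi p) by exact: nbhs_singleton.
  have := connected_locally_constant cU lh Uy Up.
  by rewrite /h gp gN// fy eqxx gtn_eqF.
move=> z Uz; have [->|zp] := pselect (z = lpi p).
  apply: filterS (nbhs_limit_pi gG cG n p) => _ [q pq <-] Uq.
  rewrite /h gp (gtn_eqF ik); case: eqP => // gq.
  have qp : lpi q <> lpi p by move=> qp; move: gq; rewrite qp gp => E; rewrite E ltnn in ik.
  by case: nex; exists q; split => //; rewrite -gN.
have [q zq] := limit_pi_surj z; move: zp Uz; rewrite {}zq => qp Uq {z}.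
have [l hl] : exists l, ~ adj l q p.
  by apply: contrapT => nl; apply: qp; apply/limit_piP => l; apply: contrapT => nql;
    apply: nl; exists l.
apply: filterS2 (lf _ (conj Uq qp)) (nbhs_limit_pi gG cG (m + l) q) => z' + [q' qq' E] Uz'.
have z'p : z' <> lpi p.
  rewrite -E => /limit_piP q'p; apply: hl; apply: hm qq' _; exact: q'p.
by move=> fz'; rewrite /h !gN// fz'.
Qed.

(** The connected neighbourhood of [q] lies over [U] because [q] is close to [p], and misses the
    puncture because [q] is not too close. *)
Lemma cut_constant n q q' : n0 <= n -> adj (m + n0) p q -> ~ adj n p q ->
  adj (c + (m + n)) q q' -> f (lpi q') = f (lpi q).
Proof.
move=> n0n pq npq qq'; have [C [cC qC Cq]] := hc (m + n) q.
have [lf _ _] := sf.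
have CU : C `<=` U `\ lpi p.
  move=> z /Cq[r qr <-]; split.
    by apply: hn0; apply: hm pq (adj_le cG _ qr); rewrite leq_add2l.
  move=> /esym /limit_piP pr; apply: npq.
  by apply: hm (pr (m + n)) _; exact: adj_sym.
apply: connected_locally_constant cC (locally_constant_sub CU lf) _ _.
- exact: qC.
- by apply: qC; exact: adj_refl.
Qed.

(** A chain from [p] to a point of the [i]-th piece is followed backwards. The label does not change
    outside the star of level [m + n], and the last point before entering that star lies in the
    shell between levels [n] and [m + n]. *)
Lemma cut_near_points i : nbhs (lpi p) U -> connected U -> i < k ->
  exists a, forall n, a <= n ->
  exists q, [/\ adj n p q, ~ adj (m + n) p q, f (lpi q) = i & adj (m + n0) p q].
Proof.
move=> pU cU ik; have [c1 hc1] := chain_nbhd gG sG rG cG NG x0.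
have [qi [pqi qip _ fqi]] := cut_clusters (c1 + (m + n0)) pU cU ik.
have [l hl] : exists l, ~ adj l p qi.
  by apply: contrapT => nl; apply: qip; apply/esym/limit_piP => l;
    apply: contrapT => nql; apply: nl; exists l.
exists (maxn n0 l) => n; rewrite geq_max => /andP[n0n ln].
have [K [pK Kp linkK]] := hc1 (m + n0) p.
have far : ~ adj (m + n) p qi.
  by move=> pq; apply: hl; apply: (adj_le cG _ pq); rewrite (leq_trans ln)// leq_addl.
elim: (linkK (c + (m + (m + n))) qi (pK _ pqi)) fqi far => [_ _ []|y z py IH yz Kz fz nz].
  exact: adj_refl.
have [pny|npy] := pselect (adj (m + n) p y).
  exists z; split => //; last exact: Kp.
  apply: hm pny (adj_le cG _ yz).
  by rewrite addnA leq_addl.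
apply: IH => //; rewrite -fz; apply/esym.
apply: (@cut_constant (m + n)) => //.
  by rewrite (leq_trans n0n)// leq_addl.
by apply: Kp; exact: linked_end py.
Qed.

Lemma cut_near_points_all : nbhs (lpi p) U -> connected U ->
  exists a, forall n, a <= n -> forall i, i < k ->
  exists q, [/\ adj n p q, ~ adj (m + n) p q, f (lpi q) = i & adj (m + n0) p q].
Proof.
move=> pU cU.
have /choice[a ha] : forall i, exists a, i < k -> forall n, a <= n ->
    exists q, [/\ adj n p q, ~ adj (m + n) p q, f (lpi q) = i & adj (m + n0) p q].
  move=> i; have [ik|_] := boolP (i < k); last by exists 0.
  by have [a ha] := cut_near_points pU cU ik; exists a.
exists (\max_(i < k) a i) => n an i ik; apply: ha => //.
by apply: leq_trans an; exact: (leq_bigmax (Ordinal ik)).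
Qed.

End Cuts.

(** * Germs *)

Lemma finite_by_codes (T U : Type) (A : set T) (C : set U) (r : T -> U -> Prop) :
  finite_set C -> (forall x, A x -> exists2 d, C d & r x d) ->
  (forall x y d, A x -> A y -> r x d -> r y d -> x = y) -> finite_set A.
Proof.
move=> fC Ar rinj; have [[a0 Aa0]|A0] := pselect (A !=set0); last first.
  by rewrite (_ : A = set0) ?finite_set0//; apply/seteqP; split=> // a Aa; case: A0; exists a.
have /choice[g hg] : forall d, exists a, (exists2 x, A x & r x d) -> A a /\ r a d.
  move=> d; have [[x Ax rx]|n] := pselect (exists2 x, A x & r x d); first by exists x.
  by exists a0.
apply: sub_finite_set (finite_image g fC) => x Ax.
have [d Cd rd] := Ar x Ax; exists d => //.
have [|Ag rg] := hg d; first by exists x.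
exact: (rinj _ _ d).
Qed.

Lemma infinite_by_sequence (T : choiceType) (A : set T) (g : nat -> T) :
  (forall i, A (g i)) -> (forall i j, i < j -> g i <> g j) -> infinite_set A.
Proof.
move=> gA ginj fA.
have := @card_ge _ A (#|` fset_set A|).+1 g fA (fun i _ => gA i) (fun i j ij _ => ginj i j ij).
by rewrite ltnn.
Qed.

(** * Finite sets of moves and the bound on cuts *)

Section Moves.
Variables (X : finType) (G : set (tree_aut X)).
Hypotheses (gG : subgroup G) (sG : self_similar G) (rG : self_replicating G).
Hypothesis cG : contracting G.
Local Notation N := (nucleus G).
Implicit Types p q r : left_words_group G.

Lemma adj_code l : exists2 C : set (seq X * tree_aut X), finite_set C &
  forall n p q, adj n p q -> exists2 us, C us &
    tile_of (l + n) q = extend us.1 (act_tile us.2 (tile_of n p)).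
Proof.
exists ([set u | size u = l] `*` N).
  by apply: finite_setX; [exact: finite_words|exact: nucleus_finite].
move=> n p q [s Ns E]; have [u ul Eq] := tile_of_add l n q.
by exists (u, s) => //=; rewrite Eq E.
Qed.

(** Such a move changes a word of [l] letters and applies a nucleus element further on;
    self-replication realizes each of these finitely many changes by one chosen element of [G]. *)
Lemma adj_moves l : exists E : set (tree_aut X), [/\ finite_set E, E `<=` G &
  forall n p q, adj n p q -> exists2 e, E e &
    tile_of (l + n) q = act_tile e (tile_of (l + n) p)].
Proof.
have H (uvs : (seq X * seq X) * tree_aut X) : exists g, G g /\
    (size uvs.1.1 = size uvs.1.2 -> G uvs.2 -> g uvs.1.1 = uvs.1.2 /\ section g uvs.1.1 = uvs.2).
  case: uvs => [[u v] s] /=.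
  have [uv|nuv] := pselect (size u = size v); last by exists 1%g; split => //; exact: subgroup1.
  have [Gs|nGs] := pselect (G s); last by exists 1%g; split => //; exact: subgroup1.
  by have [g [Gg gu gs]] := self_replicating_lift gG sG rG uv Gs; exists g.
have [f hf] := choice H.
pose W := [set u : seq X | size u = l].
exists [set f x | x in (W `*` W) `*` N]; split.
- apply: finite_image; apply: finite_setX; last exact: nucleus_finite.
  by apply: finite_setX; exact: finite_words.
- by move=> _ [x _ <-]; case: (hf x).
move=> n p q [s Ns E]; have [u ul Eq] := tile_of_add l n q.
have [v vl Ep] := tile_of_add l n p.
exists (f ((v, u), s)); first by exists ((v, u), s).
have [_ /= [||gu gs]] := hf ((v, u), s); first by rewrite ul vl.
  exact: (nucleus_in cG).
by rewrite Ep Eq act_tile_extend gu gs E.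
Qed.

Hypothesis NG : G = \bigcup_n pow N n.
Variable x0 : X.

(** Every piece has a point in a common shell around the puncture, and two such points in the same
    tile [c + (m + m)] levels deeper have the same label by [cut_constant]. The number of these
    tiles is bounded independently of the shell. *)
Lemma cut_bound : exists M, forall (z : limit_space gG cG) U k f,
  nbhs z U -> connected U -> splits (U `\ z) k f -> k <= M.
Proof.
have [m hm] := adj_trans gG cG.
have [c hc] := connected_nbhd gG sG rG cG NG x0.
have [C fC hC] := adj_code (c + (m + m)).
exists #|` fset_set C| => z U k f.
have [p ->] := limit_pi_surj z => pU cU sf.
have [n0 hn0] := nbhs_limit_piP pU.
have [a ha] := cut_near_points_all sG rG NG x0 hm hc sf hn0 pU cU.
pose n := maxn a n0.
have an : a <= n by rewrite leq_maxl.
have n0n : n0 <= m + n by rewrite (leq_trans (leq_maxr a n0)) ?leq_addl.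
have /choice[g hg] : forall i, exists us : seq X * tree_aut X, i < k -> C us /\ exists q,
    [/\ tile_of (c + (m + m) + n) q = extend us.1 (act_tile us.2 (tile_of n p)),
     ~ adj (m + n) p q, f (limit_pi gG cG q) = i & adj (m + n0) p q].
  move=> i; have [ik|_] := boolP (i < k); last by exists ([::], 1%g).
  have [q [pq npq fq pq0]] := ha n an i ik.
  by have [us Cus E] := hC _ _ _ pq; exists us => _; split => //; exists q.
apply: (@card_ge _ _ _ g) => // [i /hg[]//|i j ij jk gij].
have [_ [q [Eq npq fq pq]]] := hg i (ltn_trans ij jk).
have [_ [q' [Eq' _ fq' _]]] := hg j jk.
have := cut_constant hm hc sf hn0 n0n pq npq (q' := q').
rewrite fq fq' => H; move: ij; rewrite H ?ltnn//.
apply: tile_of_eq_adj => //; rewrite !addnA in Eq Eq' *.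
by rewrite Eq Eq' gij.
Qed.

End Moves.

Section Germs.
Variables (X : finType) (G : set (tree_aut X)).
Hypotheses (gG : subgroup G) .
Variable xi : boundary X.

Lemma tree_aut_take (g : tree_aut X) n v : g (take n v) = take n (g v).
Proof.
have [nv|vn] := leqP n (size v); last first.
  by rewrite !take_oversize// ?size_tree_aut// ltnW.
rewrite -{2}(cat_take_drop n v) sectionE take_size_cat//.
by rewrite size_tree_aut size_takel.
Qed.

Lemma mkseq_add (x : nat -> X) m n :
  exists2 v, size v = n & mkseq x (m + n) = mkseq x m ++ v.
Proof. by rewrite /mkseq iotaD map_cat; eexists; last by []; rewrite size_map size_iota. Qed.

Definition germ_base n : seq X * tree_aut X := (mkseq xi n, 1%g).

Lemma act_tile_cat (h h' : tree_aut X) u v g :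
  act_tile h (u, 1%g) = act_tile h' (u, 1%g) ->
  act_tile h (u ++ v, g) = act_tile h' (u ++ v, g).
Proof.
move=> E; have E1 : h u = h' u := congr1 fst E.
have E2 : (section h u * 1 = section h' u * 1)%g := congr1 snd E.
rewrite !mulg1 in E2.
by rewrite -[(u ++ v, g)]/(extend u (v, g)) !act_tile_extend E1 E2.
Qed.

Lemma germ_base_le (h h' : tree_aut X) m n : m <= n ->
  act_tile h (germ_base m) = act_tile h' (germ_base m) ->
  act_tile h (germ_base n) = act_tile h' (germ_base n).
Proof.
move=> /subnKC <-; have [v _ E] := mkseq_add xi m (n - m).
by rewrite /germ_base E; exact: act_tile_cat.
Qed.

(** Cylinders form a neighbourhood base at [xi], and an element is trivial on a cylinder when it
    fixes the prefix with trivial section. The trivial germs are thus the increasing union of the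
    stabilizers of the tiles [germ_base n]. *)
Lemma germ_stabilizerP g : germ_stabilizer G xi g <->
  G g /\ exists n, act_tile g (germ_base n) = germ_base n.
Proof.
split=> [[Gg /nbhs_prefix[n hn]]|[Gg [n En]]]; split => //; last first.
  have gn : g (mkseq xi n) = mkseq xi n := congr1 fst En.
  have sn : (section g (mkseq xi n) * 1 = 1)%g := congr1 snd En.
  rewrite mulg1 in sn.
  apply/nbhs_prefix; exists n => eta E.
  have fixE k : g (mkseq eta k) = mkseq eta k.
    have [v _ Ev] := mkseq_add eta n k.
    have -> : mkseq eta k = take k (mkseq eta (n + k)).
      by rewrite addnC; have [v' _ ->] := mkseq_add eta k n; rewrite take_size_cat ?size_mkseq.
    by rewrite tree_aut_take Ev E sectionE gn sn.
  apply/funext => i; rewrite /boundary_act fixE.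
  by rewrite nth_mkseq.
have fixE eta : mkseq eta n = mkseq xi n -> forall k, g (mkseq eta k) = mkseq eta k.
  move=> E k; have bE := hn eta E.
  apply: (@eq_from_nth _ (eta 0)); first by rewrite size_tree_aut.
  move=> i; rewrite size_tree_aut size_mkseq => ik.
  have := congr1 (fun e : nat -> X => e i) bE; rewrite /boundary_act => bi.
  rewrite nth_mkseq//; have Ei : mkseq eta i.+1 = take i.+1 (mkseq eta k).
    by rewrite -(subnKC ik); have [v _ ->] := mkseq_add eta i.+1 (k - i.+1);
      rewrite take_size_cat ?size_mkseq.
  rewrite -[RHS]bi Ei tree_aut_take nth_take//.
  by apply: set_nth_default; rewrite size_tree_aut size_mkseq.
have gn := fixE xi erefl n.
exists n; rewrite /act_tile /germ_base /= gn mulg1; congr pair.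
apply: tree_autP => v /=.
pose eta := nth (xi 0) (mkseq xi n ++ v).
have Ev : mkseq eta (size (mkseq xi n ++ v)) = mkseq xi n ++ v by exact: mkseq_nth.
have En : mkseq eta n = mkseq xi n.
  have := congr1 (take n) Ev; rewrite take_size_cat ?size_mkseq// => <-.
  rewrite size_cat size_mkseq; have [v' _ ->] := mkseq_add eta n (size v).
  by rewrite take_size_cat ?size_mkseq.
have := fixE eta En (size (mkseq xi n ++ v)); rewrite Ev sectionE gn.
by move=> /eqP; rewrite eqseq_cat// eqxx => /eqP.
Qed.

Definition germ (h : tree_aut X) : set (tree_aut X) :=
  [set (h * u)%g | u in germ_stabilizer G xi].

(** The vertices of the graph of germs become the direct limit of the orbits of the tiles
    [germ_base n]. *)
Lemma germP h h' : G h -> G h' ->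
  germ h = germ h' <-> exists n, act_tile h (germ_base n) = act_tile h' (germ_base n).
Proof.
move=> Gh Gh'; split=> [E|[n E]].
  have : germ h h.
    exists 1%g; last by rewrite mulg1.
    by apply/germ_stabilizerP; split; [exact: subgroup1|exists 0; rewrite act_tile1].
  rewrite E => -[u /germ_stabilizerP[Gu [n un]] <-].
  by exists n; rewrite act_tileM un.
have sub g g' : G g -> G g' -> act_tile g (germ_base n) = act_tile g' (germ_base n) ->
    germ g `<=` germ g'.
  move=> Gg Gg' Egg' _ [u /germ_stabilizerP[Gu [k uk]] <-].
  exists (g'^-1 * (g * u))%g; last by rewrite mulVKg.
  apply/germ_stabilizerP; split.
    by do 2?[apply: subgroupM => //]; exact: subgroupV.
  exists (maxn n k); rewrite !act_tileM.
  have uk' : act_tile u (germ_base (maxn n k)) = germ_base (maxn n k).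
    rewrite -[RHS]act_tile1; apply: germ_base_le (leq_maxr n k) _.
    by rewrite act_tile1.
  rewrite uk' (germ_base_le (leq_maxl n k) Egg').
  by rewrite -act_tileM mulVg act_tile1.
by apply/seteqP; split; apply: sub.
Qed.

Lemma germM s h : [set (s * a)%g | a in germ h] = germ (s * h)%g.
Proof.
apply/seteqP; split => [_ [_ [u Su <-] <-]|_ [u Su <-]].
  by exists u; rewrite ?mulgA.
by exists (h * u)%g; rewrite ?mulgA//; exists u.
Qed.

Lemma germ_in h : G h -> germ_vertices G xi (germ h).
Proof. by move=> Gh; exists h. Qed.

End Germs.

(** * From cuts to ends *)

Section GraphComponents.
Variables (V : Type) (E : V -> V -> Prop) (W : set V).

Lemma graph_component_closed (A : set V) x : A x ->
  (forall a b, A a -> W a -> W b -> E a b \/ E b a -> A b) ->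
  graph_component E W x `<=` A.
Proof.
move=> Ax cA y xy; suff [] : A x <-> A y by tauto.
elim: xy => {x y Ax} [a b [Wa Wb Eab]|//|a b _ IH|a b d _ IH1 _ IH2].
- by split=> [Aa|Ab]; [apply: cA Aa _ _ _; tauto|apply: cA Ab _ _ _; tauto].
- by tauto.
- by tauto.
Qed.

Lemma graph_component_eq x y :
  graph_component E W x y -> graph_component E W x = graph_component E W y.
Proof.
move=> xy; apply/seteqP; split => z.
  by move=> xz; apply: rst_trans (rst_sym _ _ _ _ xy) xz.
by move=> yz; apply: rst_trans xy yz.
Qed.

End GraphComponents.

Section CutsToEnds.
Variables (X : finType) (G S : set (tree_aut X)).
Hypotheses (gG : subgroup G) (sG : self_similar G) (rG : self_replicating G).
Hypothesis cG : contracting G.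
Hypotheses (finS : finite_set S) (symS : forall s, S s -> S s^-1%g).
Hypothesis genS : generates S G.
Local Notation N := (nucleus G).
Hypothesis NG : G = \bigcup_n pow N n.
Variable x0 : X.
Implicit Types p q r : left_words_group G.

Let SG : S `<=` G.
Proof. by rewrite -genS; exact: sub_gen_smallest. Qed.

Lemma germ_word (x : nat -> nat -> X) (w : set_system nat) : UltraFilter w ->
  \oo `<=` w -> exists xi : boundary X, forall l,
  w [set n | exists v, mkseq (x n) n = mkseq xi l ++ v].
Proof.
move=> uw w_oo.
have x_ l : exists y, w [set n | x n l = y].
  have [||y _ wy] := @ultra_finite w uw X setT (fun n => x n l).
  - exact: finite_finset.
  - exact: filterS filterT.
  - by exists y.
have [xi hxi] := choice x_; exists xi => l.
suff H : w [set n | mkseq (x n) l = mkseq xi l].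
  apply: filterS2 H (ultra_ge w_oo l) => n /= E ln.
  by have [v _] := mkseq_add (x n) l (n - l); rewrite subnKC// E => Ev; exists v.
elim: l => [|l IH]; first by apply: filterS filterT.
by apply: filterS2 IH (hxi l) => n /=; rewrite !mkseqS => -> ->.
Qed.

Lemma cut_to_ends (z : limit_space gG cG) U k f :
  nbhs z U -> connected U -> splits (U `\ z) k f ->
  exists (xi : boundary X) F (g : nat -> set (set (tree_aut X))),
  [/\ finite_set F, F `<=` germ_vertices G xi,
    forall i, i < k -> graph_components (germ_edge S) (germ_vertices G xi `\` F) (g i)
      /\ infinite_set (g i) &
    forall i j, i < j -> j < k -> g i <> g j].
Proof.
have [m hm] := adj_trans gG cG.
have [c hc] := connected_nbhd gG sG rG cG NG x0.
have [p ->] := limit_pi_surj z => pU cU sf.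
have [n0 hn0] := nbhs_limit_piP pU.
have [a ha] := cut_near_points_all sG rG NG x0 hm hc sf hn0 pU cU.
have [mS hmS] := adj_of_act cG finS SG.
(* [mS] levels turn a generator into an adjacency, and [c + m] give the resolution at which
   [cut_constant] preserves labels. *)
pose L := mS + (c + m).
pose t n := tile_of (L + n) p.
have [w [uw w_oo]] := ultraFilterLemma eventually_filter.
have wge := ultra_ge w_oo.
have /choice[y hy] : forall hn : tree_aut X * nat, exists q, G hn.1 ->
    tile_of (L + hn.2) q = act_tile hn.1 (t hn.2).
  move=> [h n] /=; have [Gh|nGh] := pselect (G h); last by exists p.
  have [|q Eq] := @tile_of_surj X G x0 (act_tile h (t n)).
    by apply: subgroupM => //; [exact: sG|exact: tile_of_in].
  by exists q => _; rewrite -Eq /= size_tree_aut size_word.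
have yE h n : G h -> tile_of (L + n) (y (h, n)) = act_tile h (t n) := hy (h, n).
(* The words [x_(L + n) ... x_1], read from the left, converge to [xi] along [w]. *)
have [xi hxi] : exists xi : boundary X, forall l,
    w [set n | exists v, word p.1 (L + n) = mkseq xi l ++ v].
  have [xi hxi] := germ_word (fun n => nth x0 (word p.1 (L + n))) uw w_oo.
  exists xi => l; apply: filterS (hxi l) => n [v Ev].
  have := cat_take_drop n (word p.1 (L + n)).
  have -> : take n (word p.1 (L + n)) = mkseq (nth x0 (word p.1 (L + n))) n.
    rewrite -[word p.1 (L + n) in RHS](cat_take_drop n).
    have sz : size (take n (word p.1 (L + n))) = n.
      by rewrite size_takel// size_word leq_addl.
    apply: (@eq_from_nth _ x0); first by rewrite size_mkseq sz.
    by rewrite sz => i ilt; rewrite nth_mkseq// nth_cat sz ilt.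
  by rewrite Ev -catA => /esym E; eexists; exact: E.
have germ_same h h' : G h -> G h' -> germ G xi h = germ G xi h' ->
    w [set n | tile_of (L + n) (y (h, n)) = tile_of (L + n) (y (h', n))].
  move=> Gh Gh' /(germP gG xi Gh Gh')[l E]; apply: filterS (hxi l) => n [v Ev] /=.
  by rewrite !yE// /t /tile_of Ev; exact: act_tile_cat.
(* [Sig]: the tiles of [h] stay near [p] at their own scale; [Vi i]: the others,
   whose tiles lie in the [i]-th piece for [w]-most [n]. *)
pose Sig h := G h /\ w [set n | adj n p (y (h, n))].
pose Vi i h := [/\ G h, ~ Sig h & w [set n | f (limit_pi gG cG (y (h, n))) = i]].
have Sig_germ h h' : G h' -> germ G xi h = germ G xi h' -> Sig h -> Sig h'.
  move=> Gh' E [Gh wh]; split => //.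
  apply: filterS2 wh (germ_same _ _ Gh Gh' E) => n /= pq E'.
  by apply: adj_tile_r pq; apply: tile_of_le E'; rewrite leq_addl.
have Vi_near i h h' : Vi i h ->
    w [set n | adj (c + (m + n)) (y (h, n)) (y (h', n))] ->
    w [set n | f (limit_pi gG cG (y (h', n))) = i].
  move=> [Gh nSh wf] wadj.
  have wfar : w [set n | ~ adj n p (y (h, n))].
    by apply: (ultraN uw) => wn; apply: nSh.
  have [mh hmh] := adj_of_act cG (finite_set1 h) (fun g (E : g = h) => eq_ind_r G Gh E).
  have wclose : w [set n | adj (m + n0) p (y (h, n))].
    apply: filterS (wge (mh + (m + n0))) => n /= le.
    have le' : mh <= L + n.
      by rewrite (leq_trans _ (leq_addl _ _))// (leq_trans _ le)// leq_addr.
    have := yE h n Gh; rewrite /t -(subnKC le') => /(hmh _ _ _ _ erefl).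
    by apply: adj_le => //; rewrite leq_subRL// (leq_trans le)// leq_addl.
  apply: (filterS _ (filterI (filterI wf wadj) (filterI (filterI wfar wclose) (wge n0)))).
  move=> n [[/= fn an] [[/= farn closen] n0n]].
  by rewrite -fn; apply: (cut_constant hm hc sf hn0 n0n closen farn).
pose F := [set germ G xi h | h in Sig].
pose VV i := [set germ G xi h | h in Vi i].
have F_germ h : G h -> F (germ G xi h) -> Sig h.
  by move=> Gh [h' Sh' /Sig_germ]; exact.
have VV_germ i h : G h -> VV i (germ G xi h) -> Vi i h.
  move=> Gh [h' Vh' E]; have [Gh' nS' wf'] := Vh'.
  split => //; first by move=> Sh; apply: nS'; apply: Sig_germ (esym E) Sh.
  apply: Vi_near Vh' _; apply: filterS (germ_same _ _ Gh' Gh E) => n /= E'.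
  apply: tile_of_eq_adj => //; apply: tile_of_le E'.
  by rewrite /L -!addnA leq_addl.
have Lm : m <= L by rewrite /L addnA leq_addl.
have finF : finite_set F.
  have [E [fE EG hE]] := adj_moves gG sG rG cG L.
  (* [es.1^-1 * h] fixes [xi], and its germ at [xi] is determined by its sections
   along [xi], which lie in the nucleus. *)
  pose r v (es : tree_aut X * tree_aut X) := exists h, [/\ v = germ G xi h, Sig h,
    w [set n | act_tile h (t n) = act_tile es.1 (t n)] &
    w [set l | section (es.1^-1 * h)%g (mkseq xi l) = es.2]].
  have fixed h e l : w [set n | act_tile h (t n) = act_tile e (t n)] ->
      (e^-1 * h)%g (mkseq xi l) = mkseq xi l.
    move=> wn; have [n [/= En [v Ev]]] := filter_ex (filterI wn (hxi l)).
    have : act_tile (e^-1 * h)%g (t n) = t n by rewrite act_tileM En -act_tileM mulVg act_tile1.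
    rewrite /t /tile_of Ev -[(_ ++ v, _)]/(extend (mkseq xi l) (v, \val p.2)).
    by rewrite act_tile_extend => /extend_inj[]; rewrite ?size_tree_aut.
  apply: (@finite_by_codes _ _ F (E `*` N) r); first by apply: finite_setX => //; exact: nucleus_finite.
  - move=> _ [h [Gh wh] <-].
    have [|e Ee we] := @ultra_exists w uw _ E (fun n e => act_tile h (t n) = act_tile e (t n)) fE.
      by apply: filterS wh => n /= /hE[e Ee]; rewrite yE// => ?; exists e.
    pose u := (e^-1 * h)%g.
    have Gu : G u by apply: subgroupM => //; apply: subgroupV => //; exact: EG.
    have [l0 hl0] := finite_absorbed cG (finite_set1 u) (fun g (E : g = u) => eq_ind_r G Gu E).
    have [|s Ns ws] := @ultra_finite w uw _ N (fun l => section u (mkseq xi l)) (nucleus_finite cG).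
      by apply: filterS (wge l0) => l /= ll; apply: hl0 => //; rewrite size_mkseq.
    by exists (e, s) => //; exists h; split.
  - move=> _ _ [e s] _ _ [h [-> [Gh _] we ws]] [h' [-> [Gh' _] we' ws']] /=.
    have [l [/= El El']] := filter_ex (filterI ws ws').
    apply/(germP gG xi Gh Gh'); exists l.
    have E1 g : act_tile g (germ_base xi l) = act_tile e (act_tile (e^-1 * g)%g (germ_base xi l)).
      by rewrite -act_tileM mulVKg.
    rewrite E1 [RHS]E1; congr act_tile.
    rewrite /act_tile; congr pair; first by rewrite !fixed.
    by rewrite El El'.
(* Points of the [i]-th piece in the shells of radius [n - m, n - 2m, ...]. *)
have infVV i : i < k -> infinite_set (VV i).
  move=> ik; pose d j := m * j.+1.
  have /choice[e he] : forall j, exists e, [/\ G e, w [set n | adj (n - d j) p (y (e, n))],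
      w [set n | ~ adj (m + (n - d j)) p (y (e, n))] &
      w [set n | f (limit_pi gG cG (y (e, n))) = i]].
    move=> j; have [E [fE EG hE]] := adj_moves gG sG rG cG (L + d j).
    pose P n e := exists q, [/\ tile_of (L + n) q = act_tile e (t n), adj (n - d j) p q,
      ~ adj (m + (n - d j)) p q, f (limit_pi gG cG q) = i & adj (m + n0) p q].
    have [|e Ee we] := @ultra_exists w uw _ E P fE.
      apply: filterS (wge (a + d j)) => n /= an.
      have an' : a <= n - d j by rewrite leq_subRL ?(leq_trans _ an) ?leq_addl// addnC.
      have dn : d j <= n by rewrite (leq_trans _ an)// leq_addl.
      have [q [pq npq fq pq0]] := ha _ an' i ik.
      have [e Ee Eq] := hE _ _ _ pq; rewrite -addnA subnKC// in Eq.
      by exists e => //; exists q.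
    have Ge := EG _ Ee.
    have hd n : d j <= n -> m + (n - d j) <= n.
      by move=> dn; rewrite -[X in _ <= X](subnKC dn) leq_add2r /d mulnS leq_addr.
    have hdL n : m + (n - d j) <= L + n by rewrite leq_add// leq_subr.
    exists e; split => //.
    - apply: filterS we => n /= [q [Eq pq _ _ _]]; apply: adj_tile_r pq.
      apply: (@tile_of_le _ _ _ (L + n)); last by rewrite yE.
      by rewrite (leq_trans (leq_subr _ _))// leq_addl.
    - apply: filterS we => n /= [q [Eq _ npq _ _]] pe; apply: npq; apply: adj_tile_r pe.
      by apply: (@tile_of_le _ _ _ (L + n)); rewrite ?yE.
    - apply: filterS2 we (wge (n0 + d j)) => n /= [q [Eq _ npq fq pq0]] nn.
      have n0n : n0 <= n by rewrite (leq_trans _ nn)// leq_addr.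
      have dn : d j <= n by rewrite (leq_trans _ nn)// leq_addl.
      rewrite -fq; apply: (cut_constant hm hc sf hn0 n0n pq0).
        by move=> pq; apply: npq; apply: (adj_le cG _ pq); exact: hd.
      apply: tile_of_eq_adj => //; apply: (@tile_of_le _ _ _ (L + n)); last by rewrite yE.
      by rewrite /L -!addnA leq_addl.
  apply: (@infinite_by_sequence _ _ (fun j => germ G xi (e j))).
    move=> j; have [Ge wn wf fe] := he j; exists (e j) => //; split => //.
    move=> [_ wS]; have [n [/= [pn nn] dn]] := filter_ex (filterI (filterI wS wf) (wge (d j))).
    apply: nn; apply: (adj_le cG _ pn).
    by rewrite -[X in _ <= X](subnKC dn) leq_add2r /d mulnS leq_addr.
  move=> j j' jj' /germ_same; have [Ge we _ _] := he j; have [Ge' _ we' _] := he j'.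
  move=> /(_ Ge Ge') wE.
  have [n [[/= pn npn] [En dn]]] :=
    filter_ex (filterI (filterI we we') (filterI wE (wge (d j')))).
  (* Since [d j + m] is at most [d j'], the shell [j] lies inside the star that the shell [j']
     avoids. *)
  have le : m + (n - d j') <= n - d j.
    have djj' : d j + m <= d j' by rewrite /d addnC -mulnS leq_mul2l ltnS jj' orbT.
    have djn : d j <= n by rewrite (leq_trans _ dn)// (leq_trans _ djj')// leq_addr.
    rewrite leq_subRL// addnA.
    by have := leq_add djj' (leqnn (n - d j')); rewrite (subnKC dn).
  apply: npn; apply: adj_tile_r (adj_le cG le pn).
  by apply: tile_of_le En; rewrite leq_add// leq_subr.
pose W := germ_vertices G xi `\` F.
pose E := germ_edge S.
have W_germ v : W v -> exists2 h, G h & v = germ G xi h /\ ~ Sig h.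
  by move=> [[h Gh <-] nF]; exists h => //; split => // Sh; apply: nF; exists h.
have VVW i : VV i `<=` W.
  move=> _ [h [Gh nS wf] <-]; split; first exact: germ_in.
  by move=> /(F_germ _ Gh).
have VVS i h s : S s -> VV i (germ G xi h) -> G h -> W (germ G xi (s * h)%g) ->
    VV i (germ G xi (s * h)%g).
  move=> Ss Vh Gh [_ nF]; have Vh' := VV_germ _ _ Gh Vh.
  have Gsh : G (s * h)%g by apply: subgroupM => //; exact: SG.
  exists (s * h)%g => //; split => //; first by move=> Ssh; apply: nF; exists (s * h)%g.
  apply: Vi_near Vh' _; apply: nearW => n /=.
  apply: (hmS _ _ _ s Ss).
  have -> : mS + (c + (m + n)) = L + n by rewrite /L !addnA.
  by rewrite !yE// act_tileM.
have VV_closed i u v : VV i u -> W u -> W v -> E u v \/ E v u -> VV i v.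
  move=> Vu Wu Wv; have [h Gh [Eu _]] := W_germ _ Wu; have [h' Gh' [Ev _]] := W_germ _ Wv.
  rewrite Eu Ev in Vu Wu Wv *; move=> [|] [s Ss]; rewrite germM => Es.
    by rewrite Es in Wv *; exact: VVS.
  have Es' : germ G xi h' = germ G xi (s^-1 * h)%g.
    by rewrite -germM Es germM mulKg.
  by rewrite Es' in Wv *; apply: VVS => //; exact: symS.
pose B := [set [set (s * b)%g | b in v] | s in S & v in F].
have finB : finite_set B by exact: finite_image2.
(* An [S]-word for [h] leads from the trivial germ, which lies in [F], to that of [h]; after its
   last visit to [F] it stays in one component. So every component meets the finite set [B]. *)
have reach v : W v -> exists b, [/\ B b, W b & graph_component E W b v].
  move=> /[dup] Wv /W_germ[h Gh [Ev nS]].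
  have := Gh; rewrite [in X in X -> _](generates_pow symS genS) => -[n _ pn].
  rewrite {}Ev in Wv *; elim: n h Gh pn nS Wv => [|n IH] h Gh /=.
    move=> -> nS1 _; case: nS1; split; first exact: subgroup1.
    apply: filterS filterT => n _ /=; apply: tile_of_eq_adj => //; apply: (@tile_of_le _ _ _ (L + n)).
      by rewrite leq_addl.
    by rewrite yE ?act_tile1//; exact: subgroup1.
  move=> [s Ss [h1 ph1 Eh]] nS Wh.
  have Gh1 : G h1 by exact: (pow_sub gG SG ph1).
  have [Sh1|nSh1] := pselect (Sig h1).
    exists (germ G xi h); split => //; last exact: rst_refl.
    by exists s => //; exists (germ G xi h1); [exists h1|rewrite germM Eh].
  have Wh1 : W (germ G xi h1) by split; [exact: germ_in|move=> /(F_germ _ Gh1)].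
  have [b [Bb Wb bh1]] := IH h1 Gh1 ph1 nSh1 Wh1.
  exists b; split => //; apply: rst_trans bh1 _; apply: rst_step; split => //.
  by exists s => //; rewrite germM Eh.
(* Finitely many components cover the infinite set [VV i], so one of them is infinite. *)
have comp i : exists C, i < k -> exists2 b, VV i b & C = graph_component E W b /\ infinite_set C.
  have [ik|_] := boolP (i < k); last by exists set0.
  have [b [[Bb Vb] infb]] : exists b, (B b /\ VV i b) /\ infinite_set (graph_component E W b).
    apply: contrapT => nex; apply: (infVV i ik).
    apply: (@sub_finite_set _ _ (\bigcup_(b in B `&` VV i) graph_component E W b)).
      move=> v Vv; have [b [Bb Wb bv]] := reach v (VVW _ _ Vv).
      exists b => //; split => //.
      have := graph_component_closed Vv (VV_closed i); apply.
      exact: rst_sym.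
    apply: bigcup_finite; first by apply: sub_finite_set finB => b [].
    by move=> b Bb; apply: contrapT => infb; apply: nex; exists b.
  by exists (graph_component E W b) => _; exists b.
have /choice[g hg] := comp.
exists xi, F, g; split => //.
- by move=> _ [h [Gh _] <-]; exact: germ_in.
- move=> i ik; have [b Vb [Eg infg]] := hg i ik; split => //.
  by rewrite Eg; exists b => //; exact: VVW Vb.
- move=> i j ij jk gij.
  have [b Vb [Eb _]] := hg i (ltn_trans ij jk); have [b' Vb' [Eb' _]] := hg j jk.
  have Vb1 : VV i b'.
    apply: (graph_component_closed Vb (VV_closed i)).
    by rewrite -/W -/E -Eb gij Eb'; exact: rst_refl.
  have [h [Gh _ wf] Eh] := Vb'; rewrite -Eh in Vb1.
  have [_ _ wf'] := VV_germ _ _ Gh Vb1.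
  have [n [/= fi fj]] := filter_ex (filterI wf wf').
  by rewrite -fi fj ltnn in ij.
Qed.

End CutsToEnds.

(** * From ends to cuts *)

Section EndsToCuts.
Variables (X : finType) (G S : set (tree_aut X)).
Hypotheses (gG : subgroup G) (sG : self_similar G) (rG : self_replicating G).
Hypothesis cG : contracting G.
Hypotheses (finS : finite_set S) (symS : forall s, S s -> S s^-1%g).
Hypothesis genS : generates S G.
Local Notation N := (nucleus G).
Hypothesis NG : G = \bigcup_n pow N n.
Variable x0 : X.
Implicit Types p q r : left_words_group G.

Let SG : S `<=` G.
Proof. by rewrite -genS; exact: sub_gen_smallest. Qed.

Lemma germ_prefix (xi : boundary X) h h' n : G h -> G h' ->
  germ G xi h = germ G xi h' -> h (mkseq xi n) = h' (mkseq xi n).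
Proof.
move=> Gh Gh' /(germP gG xi Gh Gh')[l /(germ_base_le (leq_maxl l n))].
move=> /(congr1 fst) /= /(congr1 (take n)).
rewrite -!tree_aut_take -(subnKC (leq_maxr l n)).
have [v _ ->] := mkseq_add xi n (maxn l n - n).
by rewrite take_size_cat ?size_mkseq.
Qed.

Lemma nucleus_words : exists a, forall s, N s -> exists2 j, j <= a & pow S j s.
Proof.
have H s : exists j, N s -> pow S j s.
  have [/(nucleus_in cG)|nE] := pselect (N s); last by exists 0 => /nE.
  by rewrite [in X in X -> _](generates_pow symS genS) => -[j _ pj]; exists j.
have [b hb] := choice H.
exists (\max_(s <- fset_set N) b s) => s Ns; exists (b s); last exact: hb.
by apply: leq_bigmax_seq => //; rewrite in_fset_set ?inE//; exact: nucleus_finite.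
Qed.

(** Vertices in none of the chosen components all get the label [k.-1]. Within [W] they form a union
    of components, so [t] stays constant along edges. *)
Lemma component_types (V : Type) (W : set V) (E : V -> V -> Prop) k (g : nat -> set V) :
  0 < k -> (forall i, i < k -> graph_components E W (g i)) ->
  (forall i j, i < j -> j < k -> g i <> g j) ->
  exists t : V -> nat, [/\ forall v, t v < k,
    forall i v, i < k -> g i v -> t v = i &
    forall u v, W u -> W v -> E u v -> t u = t v].
Proof.
move=> k0 gc ginj.
have guniq i j v : i < k -> j < k -> g i v -> g j v -> i = j.
  have comp_eq l : l < k -> g l v -> g l = graph_component E W v.
    by move=> /gc[x _ <-]; exact: graph_component_eq.
  move=> ik jk giv gjv; have E1 := comp_eq i ik giv; have E2 := comp_eq j jk gjv.
  by case: (ltngtP i j) => // ij; [case: (ginj i j)|case: (ginj j i)]; rewrite // E1 E2.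
have H v : exists n, [/\ n < k, forall i, i < k -> g i v -> n = i &
    (forall i, i < k -> ~ g i v) -> n = k.-1].
  have [[i [ik giv]]|ng] := pselect (exists i, i < k /\ g i v).
    exists i; split => //; last by move=> /(_ i ik).
    by move=> j jk gjv; exact: guniq ik jk giv gjv.
  exists k.-1; split => //; first by rewrite prednK.
  by move=> i ik giv; case: ng; exists i.
have [t ht] := choice H; exists t; split.
- by move=> v; case: (ht v).
- by move=> i v ik giv; case: (ht v) => _ + _; exact.
move=> u v Wu Wv Euv.
have euv i : i < k -> g i u <-> g i v.
  move=> /gc[x _ <-]; split => xu; apply: rst_trans xu _.
    exact: rst_step.
  by apply: rst_sym; exact: rst_step.
have [_ tu tu'] := ht u; have [_ tv tv'] := ht v.
have [[i [ik giv]]|ng] := pselect (exists i, i < k /\ g i v).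
  by rewrite (tu i)// ?(tv i)//; exact/(euv i ik).
rewrite tu' ?tv'// => i ik giv; apply: ng; exists i; split => //.
by exact/(euv i ik).
Qed.

Lemma ends_to_cut (xi : boundary X) F k (g : nat -> set (set (tree_aut X))) :
  0 < k -> finite_set F ->
  (forall i, i < k -> graph_components (germ_edge S) (germ_vertices G xi `\` F) (g i)
      /\ infinite_set (g i)) ->
  (forall i j, i < j -> j < k -> g i <> g j) ->
  exists (z : limit_space gG cG) U f,
    [/\ nbhs z U, connected U & splits (U `\ z) k f].
Proof.
move=> k0 finF gc ginj.
have [m hm] := adj_trans gG cG.
have [c hc] := connected_nbhd gG sG rG cG NG x0.
have [c1 hc1] := chain_nbhd gG sG rG cG NG x0.
have [mS hmS] := adj_of_act cG finS SG.
have [a ha] := nucleus_words.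
have [w [uw w_oo]] := ultraFilterLemma eventually_filter.
have wge := ultra_ge w_oo.
pose E := germ_edge S; pose W := germ_vertices G xi `\` F.
pose germ := germ G xi; pose base := germ_base xi.
have [t [tk tg tE]] := component_types k0 (fun i ik => (gc i ik).1) ginj.
have /choice[hh0 hhP] : forall qn : left_words_group G * nat, exists h, G h /\
    tile_of qn.2 qn.1 = act_tile h (base qn.2).
  move=> [q n] /=.
  have [|h [Gh hu hs]] := self_replicating_lift gG sG rG (u := mkseq xi n)
    (v := word q.1 n) _ (tile_of_in n q).
    by rewrite size_mkseq size_word.
  by exists h; rewrite /act_tile /base /germ_base /= hu hs mulg1.
pose hh q n := hh0 (q, n).
have Ghh q n : G (hh q n) by case: (hhP (q, n)).
have hhE q n : tile_of n q = act_tile (hh q n) (base n) by case: (hhP (q, n)).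
pose v n q := germ (hh q n).
(* Elements moving the base tile alike have the same germ, so [v n q] does not depend on the choice
   of [hh q n]. *)
have vE n q h : G h -> tile_of n q = act_tile h (base n) -> v n q = germ h.
  by move=> Gh Eq; apply/(germP gG xi (Ghh q n) Gh); exists n; rewrite -hhE.
have v_tile n q q' : tile_of n q = tile_of n q' -> v n q = v n q'.
  by move=> Eq; apply: vE => //; rewrite Eq.
have v_act n q q' s : G s -> tile_of n q' = act_tile s (tile_of n q) ->
    v n q' = germ (s * hh q n)%g.
  by move=> Gs Eq; apply: vE; [exact: subgroupM|rewrite act_tileM -hhE].
(* A tile is bad if it is within an [S]-path, of the length needed for elements of
   the nucleus, of a lift of [F]; [Z] consists of the limits of bad tiles. *)
pose Bad n q := exists2 j, j <= a & exists2 e, pow S j e & F (germ (e * hh q n)%g).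
(* A nucleus element is an [S]-word of length at most [a]; from a tile that is not bad, its partial
   products give germs outside [F], along which [t] is constant. *)
have step n q q' : adj n q q' -> ~ Bad n q -> t (v n q') = t (v n q).
  move=> [s Ns Eq] nB; have [j ja pj] := ha s Ns.
  rewrite (v_act n q q' s (nucleus_in cG Ns) Eq).
  have Gp i e : pow S i e -> G e by exact: (pow_sub gG SG).
  have nF i e : i <= a -> pow S i e -> W (germ (e * hh q n)%g).
    move=> ia pe; split; first exact: (germ_in xi (subgroupM gG (Gp _ _ pe) (Ghh q n))).
    by move=> Fe; apply: nB; exists i => //; exists e.
  elim: j s ja pj {Ns Eq} => [|j IH] s ja /=; first by move=> ->; rewrite mul1g.
  move=> [s1 Ss1 [s2 ps2 <-]]; rewrite -(IH s2)//; last exact: ltnW.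
  apply/esym; apply: tE; first by apply: nF ps2; exact: ltnW.
    by apply: nF ja _; exists s1 => //; exists s2.
  by exists s1 => //; rewrite germM mulgA.
have /choice[bp bpE] : forall n, exists q, tile_of n q = base n.
  move=> n; have [|q Eq] := @tile_of_surj X G x0 (base n); first exact: subgroup1.
  by exists q; rewrite -Eq /= size_mkseq.
have [|p hp] := point_limit uw (finite_set1 1%g) (q_ := bp).
  by apply: filterS filterT => n _ /=; have /(congr1 snd) := bpE n.
pose Z z := forall l, w [set n | exists2 q, adj l z q & Bad n q].
have Z_sat q q' : limit_pi gG cG q = limit_pi gG cG q' -> Z q -> Z q'.
  move=> /esym /limit_piP q'q Zq l; apply: filterS (Zq (m + l)) => n [r qr Br].
  by exists r => //; apply: hm qr; exact: q'q.
(* Near a point outside [Z] there are no bad tiles for most [n], so [t] is constant along chains. *)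
have type_near q : ~ Z q -> exists l, w [set n | forall q', adj l q q' -> t (v n q') = t (v n q)].
  move=> /existsNP[l /(ultraN uw) wl]; have [K [qK Kq linkK]] := hc1 l q.
  exists (c1 + l); apply: filterS wl => n /= nB q' /qK Kq'.
  elim: (linkK n q' Kq') => // b d qb IH bd Kd; rewrite -IH.
  apply: step bd _ => Bb; apply: nB; exists b => //; apply: Kq; exact: linked_end qb.
(* Near [p], a class in [Z] is determined by a germ and a group element from finite sets. Points of
   [Z] tending to [p] would share one code along the ultrafilter, hence one class, which is that of
   [p]. *)
have [n0 hn0] : exists n0, forall q, adj n0 p q -> Z q ->
    limit_pi gG cG q = limit_pi gG cG p.
  pose Bs := \bigcup_(j in `I_a.+1) pow S j.
  have finBs : finite_set Bs.
    by apply: bigcup_finite; [exact: finite_II|move=> j _; exact: finite_pow].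
  pose SS := [set [set (e^-1 * b)%g | b in u] | e in Bs & u in F].
  pose Ga := [set (s * (s' * \val p.2))%g | s in N & s' in N].
  have finC : finite_set (SS `*` Ga).
    apply: finite_setX; first exact: finite_image2.
    by apply: finite_image2; exact: nucleus_finite.
  pose R z (d : set (tree_aut X) * tree_aut X) := forall l,
    w [set n | exists q, [/\ adj l z q, v n q = d.1 & \val q.2 = d.2]].
  have code z : Z z -> adj 0 p z -> exists2 d, (SS `*` Ga) d & R z d.
    move=> Zz pz.
    have /choice[dd hd] : forall l, exists d, (SS `*` Ga) d /\
        w [set n | exists q, [/\ adj l z q, v n q = d.1 & \val q.2 = d.2]].
      move=> l; have [|d Cd wd] := @ultra_exists w uw _ (SS `*` Ga)
        (fun n d => exists q, [/\ adj l z q, v n q = d.1 & \val q.2 = d.2]) finC.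
        apply: filterS (Zz l) => n /= [q zq [j ja [e pe Fe]]].
        exists (v n q, \val q.2); last by exists q.
        split => /=; last first.
          have [s Ns ->] := adj_in cG zq; have [s' Ns' ->] := adj_in cG pz.
          by exists s => //; exists s'.
        exists e; first by exists j.
        by exists (germ (e * hh q n)%g) => //; rewrite germM mulKg.
      by exists d.
    have [|d Cd wd] := @ultra_finite w uw _ _ dd finC.
      by apply: filterS filterT => l _; case: (hd l).
    exists d => // l; have [l' [/= dl' ll']] := filter_ex (filterI wd (wge l)).
    have [_ wl'] := hd l'; rewrite dl' in wl'.
    by apply: filterS wl' => n [q [zq vq gq]]; exists q; split => //; exact: adj_le ll' zq.
  (* By [germ_prefix] the germ determines the word of a tile, and the other entry of the code is its
     group component; equal codes give a common tile at high levels. *)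
  have code_inj z z' d : R z d -> R z' d -> limit_pi gG cG z = limit_pi gG cG z'.
    move=> Rz Rz'; apply/limit_piP => l.
    have [n [[/= [q [zq vq gq]] [q' [zq' vq' gq']]] ln]] :=
      filter_ex (filterI (filterI (Rz (m + (m + l))) (Rz' (m + (m + l)))) (wge (m + (m + l)))).
    have vv : v n q = v n q' by rewrite vq vq'.
    have qq' : tile_of n q = tile_of n q'.
      have wE r : word r.1 n = hh r n (mkseq xi n) by have /(congr1 fst) := hhE r n.
      rewrite /tile_of !wE; congr pair; first exact: germ_prefix vv.
      exact: etrans gq (esym gq').
    apply: (hm _ _ q'); last first.
      by apply: adj_sym => //; apply: adj_le zq' => //; rewrite leq_addl.
    apply: hm zq _; apply: (adj_le cG ln); exact: tile_of_eq_adj.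
  apply: contrapT => nex.
  have /choice[z hz] : forall n, exists z, [/\ adj n p z, Z z &
      limit_pi gG cG z <> limit_pi gG cG p].
    move=> n; apply: contrapT => nz; apply: nex; exists n => q pq Zq.
    by apply: contrapT => qp; apply: nz; exists q.
  have /choice[d hd] : forall n, exists d, (SS `*` Ga) d /\ R (z n) d.
    move=> n; have [pz Zz _] := hz n.
    by have [d Cd Rd] := code _ Zz (adj_le cG (leq0n n) pz); exists d.
  have [|d0 _ wd] := @ultra_finite w uw _ _ d finC.
    by apply: filterS filterT => n _; case: (hd n).
  have [n1 /= dn1] := filter_ex wd.
  have [_ _ zp] := hz n1; apply: zp; apply/esym/limit_piP => l.
  have [n2 [/= dn2 ln2]] := filter_ex (filterI wd (wge (m + l))).
  have [_ R1] := hd n1; have [_ R2] := hd n2; rewrite dn1 in R1; rewrite dn2 in R2.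
  have /limit_piP zz := code_inj _ _ _ R2 R1.
  have [pz2 _ _] := hz n2.
  by apply: hm (adj_le cG ln2 pz2) (zz _).
have [C [cC pC Cp]] := hc n0 p.
have /choice[ff hff] : forall q, exists i, w [set n | t (v n q) = i].
  move=> q; have [||i _ wi] := @ultra_finite w uw _ `I_k (fun n => t (v n q)).
  - exact: finite_II.
  - by apply: filterS filterT => n _ /=.
  - by exists i.
have ffE q i : w [set n | t (v n q) = i] -> ff q = i.
  by move=> wi; have [n [/= <- <-]] := filter_ex (filterI wi (hff q)).
have ff_near q : ~ Z q -> exists l, forall q', adj l q q' -> ff q' = ff q.
  move=> /type_near[l wl]; exists l => q' qq'; apply: ffE.
  by apply: filterS2 wl (hff q) => n /= /(_ q' qq') -> ->.
(* The label is read at a chosen representative; outside [Z] equivalent points have the same label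
   by [ff_near]. *)
pose f (y : limit_space gG cG) := ff (repr y).
have reprE (y : limit_space gG cG) : limit_pi gG cG (repr y) = y by rewrite /limit_pi reprK.
have ff_pi q : ~ Z q -> f (limit_pi gG cG q) = ff q.
  move=> /ff_near[l hl]; rewrite /f; apply: hl.
  by move: l; apply/limit_piP; rewrite reprE.
exists (limit_pi gG cG p), C, f; split => //.
  apply: filterS (nbhs_limit_pi gG cG (c + n0) p) => _ [q pq <-]; exact: pC.
split.
- move=> y [Cy yp]; have nZ : ~ Z (repr y).
    have [q pq Eq] := Cp _ Cy; move=> Zy; apply: yp; rewrite -Eq.
    by apply: hn0 => //; apply: Z_sat Zy; rewrite reprE.
  have [l hl] := ff_near _ nZ.
  have := nbhs_limit_pi gG cG (m + l) (repr y); rewrite reprE.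
  apply: filterS => _ [q yq <-] _; rewrite /f; apply: hl.
  apply: hm yq _; move: (m + l); apply/limit_piP.
  by rewrite reprE.
- move=> y _; rewrite /f.
  by have [n /= <-] := filter_ex (hff (repr y)).
(* Points [n1]-adjacent to [p] lie over [C], and a limit of points that are not [n2]-adjacent to [p]
   is not equivalent to [p]. *)
move=> i ik; pose n1 := c + n0; pose n2 := m + n1.
have [[x Wx gx] infg] := gc i ik.
(* The lift of the [i]-th component from near the base tile leaves every bounded
   set, since bounded sets contain finitely many tiles of level [n]. *)
have exits : w [set n | exists y, [/\ adj n1 p y, ~ adj n2 p y & g i (v n y)]].
  have [[h Gh Eh] _] := Wx.
  have [mh hmh] := adj_of_act cG (finite_set1 h) (fun e (Ee : e = h) => eq_ind_r G Gh Ee).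
  apply: filterS2 (hp (m + n2)) (wge ((mh + mS) + (m + n2))) => n /= bpp nle.
  have nh : mh + (m + n2) <= n by rewrite (leq_trans _ nle)// leq_add2r leq_addr.
  have nS : mS + (m + n1) <= n.
    by rewrite (leq_trans _ nle)// leq_add ?leq_addl// leq_add2l leq_addl.
  apply: contrapT => nex.
  have stay y : adj n1 p y -> g i (v n y) -> adj n2 p y.
    by move=> py gy; apply: contrapT => npy; apply: nex; exists y.
  (* If the component has no lift in the shell, an [S]-step from the star of level [n2] lands in
     that of level [n1], hence again in that of level [n2]: the whole component is confined
     there. *)
  have all_near : g i `<=` [set u | g i u /\ exists2 y, adj n2 p y & v n y = u].
    rewrite -{1}gx; apply: graph_component_closed; first split.
    - by rewrite -gx; exact: rst_refl.
    - have [|y Ey] := @tile_of_surj X G x0 (act_tile h (base n)).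
        by apply: subgroupM => //; [exact: sG|exact: subgroup1].
      rewrite /= size_tree_aut size_mkseq in Ey.
      exists y; last by rewrite -Eh; exact: vE.
      apply: (hm _ _ (bp n)); first by apply: tile_of_eq_adj.
      rewrite -bpE in Ey; rewrite -(subnKC (leq_trans (leq_addr _ _) nh)) in Ey.
      have := hmh _ _ _ h erefl Ey; rewrite (subnKC (leq_trans (leq_addr _ _) nh)).
      apply: adj_le => //.
      by rewrite leq_subRL// (leq_trans (leq_addr _ _) nh).
    move=> b d [gb [y py vy]] Wb Wd Ebd; have gd : g i d.
      rewrite -gx in gb *; apply: rst_trans gb _.
      by case: Ebd => Ebd; [exact: rst_step|apply: rst_sym; exact: rst_step].
    split => //.
    have [s Ss Ed] : exists2 s, S s & d = germ (s * hh y n)%g.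
      case: Ebd => -[s Ss Es]; first by exists s => //; rewrite Es -vy /v /germ germM.
      have [[e Ge Ee] _] := Wd.
      exists s^-1%g; first exact: symS.
      have Ee' : d = germ e := esym Ee.
      have : germ (s^-1 * hh y n)%g = germ (s^-1 * (s * e))%g.
        by rewrite /germ -!germM -/(germ _) -/(v n y) vy Es Ee'.
      by rewrite mulKg -Ee'.
    have [|y' Ey'] := @tile_of_surj X G x0 (act_tile s (tile_of n y)).
      by apply: subgroupM => //; [exact/sG/SG|exact: tile_of_in].
    rewrite /= size_tree_aut size_word in Ey'.
    have vy' : v n y' = d by rewrite Ed; apply: v_act => //; exact: SG.
    exists y' => //; apply: stay; last by rewrite vy'.
    apply: (hm _ _ y); first by apply: adj_le py => //.
    rewrite -(subnKC (leq_trans (leq_addr _ _) nS)) in Ey'.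
    have := hmS _ _ _ s Ss Ey'; apply: adj_le => //.
    by rewrite leq_subRL// (leq_trans (leq_addr _ _) nS).
  apply: infg.
  have n2n : n2 <= n by rewrite (leq_trans _ nh)// addnA leq_addl.
  have [D finD hD] := adj_code cG (n - n2).
  apply: (@finite_by_codes _ _ (g i) D (fun u us => exists y, v n y = u /\
    tile_of n y = extend us.1 (act_tile us.2 (tile_of n2 p)))) => //.
  - move=> u /all_near[_ [y py vy]]; have [us Dus] := hD _ _ _ py.
    by rewrite subnK// => Ey; exists us => //; exists y.
  - move=> u u' us _ _ [y [<- Ey]] [y' [<- Ey']]; apply: v_tile.
    by rewrite Ey Ey'.
have /choice[y hy] : forall n, exists y, (exists y, [/\ adj n1 p y, ~ adj n2 p y & g i (v n y)]) ->
    [/\ adj n1 p y, ~ adj n2 p y & g i (v n y)].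
  move=> n; have [[y hy]|ny] := pselect (exists y, [/\ adj n1 p y, ~ adj n2 p y & g i (v n y)]).
    by exists y.
  by exists p.
have [|q hq] := @adj_limit _ _ cG w n1 p y uw.
  by apply: filterS exits => n /= /hy[].
have [n [[/= /hy[py npy _] E1] E2]] := filter_ex (filterI (filterI exits (hq n1)) (hq n2)).
have pq : adj n1 p q by exact: adj_tile_r py.
have npq : ~ adj n2 p q by move=> pq'; apply: npy; exact: adj_tile_r (esym E2) pq'.
have qp : limit_pi gG cG q <> limit_pi gG cG p.
  by move=> /esym /limit_piP pq'; apply: npq.
have nZ : ~ Z q.
  by move=> Zq; apply: qp; apply: hn0 => //; apply: adj_le pq => //; rewrite leq_addl.
exists (limit_pi gG cG q); first by split => //; exact: pC.
rewrite (ff_pi _ nZ); apply: ffE; have [l wl] := type_near _ nZ.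
apply: filterS2 wl (filterI exits (hq l)) => k' /= tq [/hy[_ _ gy] Eq].
rewrite -(tq (y k')); first exact: tg gy.
exact: tile_of_eq_adj.
Qed.

End EndsToCuts.

(** * Equality of the two suprema *)

Local Open Scope ereal_scope.

(** Finite sequences suffice: an infinite [A] would contain more than [M] elements, against the
    bound on [b]. *)
Lemma counting_le_sequences (R : realType) (T : choiceType) (A : set T)
    (b : \bar R) M :
  0 <= b -> b <= M%:R%:E ->
  (forall k g, (forall i, (i < k)%N -> A (g i)) ->
    (forall i j, (i < j)%N -> (j < k)%N -> g i <> g j) -> k%:R%:E <= b) ->
  counting A <= b.
Proof.
move=> b0 bM H.
have [[t]|nT] := pselect (inhabited T); last first.
  rewrite (_ : A = set0); last by apply/seteqP; split => // x; case: nT.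
  by rewrite /counting asboolT// fset_set0.
have Hf (D : {fset T}) : [set` D] `<=` A -> #|` D|%:R%:E <= b.
  move=> DA; apply: (H _ (nth t D)) => [i iD|i j ij jD /eqP].
    by apply: DA; exact: mem_nth.
  by rewrite nth_uniq ?fset_uniq ?(ltn_trans ij jD)//; move: ij; case: eqP => // ->; rewrite ltnn.
rewrite /counting; case: ifPn => [/asboolP fA|/asboolP iA].
  by apply: Hf; rewrite fset_setK.
have [D DA Dk] := infinite_set_fset M.+1 iA.
have := le_trans (Hf _ DA) bM.
by rewrite lee_fin ler_nat leqNgt Dk.
Qed.

Theorem theorem2 (R : realType) (X : finType) (G S : set (tree_aut X))
    (gG : subgroup G) (sG : self_similar G) (rG : self_replicating G)
    (cG : contracting G)
    (finS : finite_set S) (symS : forall s, S s -> S (s^-1)%g)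
    (genS : generates S G) :
  let ends : \bar R := card_sup
    [set number_of_ends R (germ_vertices G xi) (germ_edge S)
    | xi in [set: boundary X]] in
  let cuts : \bar R := card_sup
    [set k | exists (zeta : limit_space gG cG) (U : set (limit_space gG cG)),
      [/\ nbhs zeta U, connected U & k = counting (components (U `\ zeta))]] in
  [/\ ends \is a fin_num, cuts \is a fin_num & ends = cuts].
Proof.
move=> ends cuts.
have ends0 : 0 <= ends by apply: ereal_sup_ubound; left.
have cuts0 : 0 <= cuts by apply: ereal_sup_ubound; left.
(* Over the empty alphabet the boundary and the limit space are empty, so both suprema are 0. *)
have [x0|nX] := pselect (inhabited X); last first.
  have endsE : ends <= 0.
    apply: ge_ereal_sup => e [->//|[xi _ _]].
    by case: nX; exists; exact: (xi 0%N).
  have cutsE : cuts <= 0.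
    apply: ge_ereal_sup => e [->//|[z _]]; have [p _] := limit_pi_surj z.
    by case: nX; exists; exact: (p.1 0%N).
  have -> : ends = 0 by apply/eqP; rewrite eq_le endsE.
  by have -> : cuts = 0 by apply/eqP; rewrite eq_le cutsE.
case: x0 => x0; have NG := nucleus_pow gG sG rG cG x0 finS genS.
have [M hM] := cut_bound gG sG rG cG NG x0.
have cuts_splits (z : limit_space gG cG) U k f : nbhs z U -> connected U -> splits (U `\ z) k f ->
    k%:R%:E <= cuts.
  move=> zU cU sf; apply: le_trans (components_ge R sf) _.
  by apply: ereal_sup_ubound; right; exists z, U.
have max_cut (z : limit_space gG cG) U : nbhs z U -> connected U -> exists k f, [/\ (k <= M)%N,
    splits (U `\ z) k f & counting (components (U `\ z)) <= k%:R%:E :> \bar R].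
  move=> zU cU; have [k [f [sf cf]]] := max_splits (fun k f => hM z U k f zU cU).
  by exists k, f; split; [exact: hM sf|exact: sf|exact: components_le sf cf].
have cutsM : cuts <= M%:R%:E.
  apply: ge_ereal_sup => _ [->|[z [U [zU cU ->]]]]; first by rewrite lee_fin ler0n.
  have [k [f [kM _ le]]] := max_cut z U zU cU.
  by apply: le_trans le _; rewrite lee_fin ler_nat.
have le_cuts : ends <= cuts.
  apply: ge_ereal_sup => _ [->//|[xi _ <-]].
  apply: ge_ereal_sup => _ [F [finF FV] <-].
  apply: (counting_le_sequences cuts0 cutsM) => -[|k] g gA ginj; first exact: cuts0.
  have [z [U [f [zU cU sf]]]] := ends_to_cut gG sG rG cG finS symS genS NG x0
    (ltn0Sn k) finF gA ginj.
  exact: cuts_splits zU cU sf.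
have le_ends : cuts <= ends.
  apply: ge_ereal_sup => _ [->//|[z [U [zU cU ->]]]].
  have [k [f [_ sf le]]] := max_cut z U zU cU; apply: le_trans le _.
  have [xi [F [g [finF FV gc ginj]]]] :=
    cut_to_ends sG rG finS symS genS NG x0 zU cU sf.
  apply: (@le_trans _ _ (number_of_ends R (germ_vertices G xi) (germ_edge S))); last first.
    by apply: ereal_sup_ubound; right; exists xi.
  apply: (@le_trans _ _ (counting (graph_components (germ_edge S)
    (germ_vertices G xi `\` F) `&` [set C | infinite_set C]))).
    exact: (counting_ge _ gc ginj).
  by apply: ereal_sup_ubound; exists F.
have eqec : ends = cuts by apply/eqP; rewrite eq_le le_cuts.
have fin : cuts \is a fin_num.
  by rewrite ge0_fin_numE//; apply: le_lt_trans cutsM _; rewrite ltry.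
by rewrite eqec.
Qed.
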